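(* Let $\mathbf n\ge 2$ and let $M_{\langle\mathbf n\rangle}\in\mathbb C^{\mathbf n^2}\otimes\mathbb C^{\mathbf n^2}\otimes\mathbb C^{\mathbf n^2}$ be the $\mathbf n\times\mathbf n$ matrix multiplication tensor. Then $\underline{\mathbf R}(M_{\langle\mathbf n\rangle})\ge 2\mathbf n^2-\mathbf n+1$.
   Context: $M_{\langle\mathbf n\rangle}=\sum_{i,j,k=1}^{\mathbf n}x^i_j\otimes y^j_k\otimes z^k_i$ where $\{x^i_j\},\{y^j_k\},\{z^k_i\}$ are bases of the three copies of $\mathbb C^{\mathbf n^2}$. The border rank $\underline{\mathbf R}(T)$ of a tensor $T$ is the smallest $r$ such that $T$ is a limit of sums of $r$ rank one tensors $a\otimes b\otimes c$. *)

(* Defs.v *)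
From Stdlib Require Import Reals.
Open Scope R_scope.

Record Cplx := mkC { Re : R; Im : R }.
Definition C0 : Cplx := mkC 0 0.
Definition C1 : Cplx := mkC 1 0.
Definition Cadd (z w : Cplx) : Cplx := mkC (Re z + Re w) (Im z + Im w).
Definition Csub (z w : Cplx) : Cplx := mkC (Re z - Re w) (Im z - Im w).
Definition Cmul (z w : Cplx) : Cplx :=
  mkC (Re z * Re w - Im z * Im w) (Re z * Im w + Im z * Re w).
Definition Cmod (z : Cplx) : R := sqrt (Re z * Re z + Im z * Im z).

Fixpoint Csum (r : nat) (f : nat -> Cplx) : Cplx :=
  match r with
  | O => C0
  | S r' => Cadd (Csum r' f) (f r')
  end.

(* Basis index (i,j) with i,j < n of C^{n^2} = C^{n x n}. *)
Definition idx := (nat * nat)%type.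
Definition in_range (n : nat) (a : idx) : Prop := (fst a < n)%nat /\ (snd a < n)%nat.

(* A vector of C^{n^2}: coordinates indexed by pairs (only in-range ones matter). *)
Definition vec := idx -> Cplx.
Definition tensor := idx -> idx -> idx -> Cplx.

(* Matrix multiplication tensor M_<n> = sum_{i,j,k} x^i_j (x) y^j_k (x) z^k_i :
   coefficient at (x^{a1}_{a2}, y^{b1}_{b2}, z^{c1}_{c2}) is 1 iff
   a2 = b1, b2 = c1, c2 = a1. *)
Definition matmul_tensor : tensor := fun a b c =>
  if (Nat.eqb (snd a) (fst b) && Nat.eqb (snd b) (fst c) && Nat.eqb (snd c) (fst a))%bool
  then C1 else C0.

Definition border_rank_le (n : nat) (T : tensor) (r : nat) : Prop :=
  forall eps : R, eps > 0 ->
  exists (u v w : nat -> vec),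
    forall a b c, in_range n a -> in_range n b -> in_range n c ->
      Cmod (Csub (T a b c)
                 (Csum r (fun l => Cmul (Cmul (u l a) (v l b)) (w l c)))) < eps.

(* Main.v *)
Require Import Defs.
From Stdlib Require Import Reals.

(* If M_<n> = lim_k sum_t u_t v_t w_t with r terms, quotienting the first factor A by u_1
   leaves r - 1 terms; normalizing u_1 and passing to a limit x, one may follow the
   quotient by a projection A -> C^(2n-1) killing x.  Take it of the form
   X |-> (g_l^T X h_l)_l with the g_l, and the h_l, in general position: in the basis
   indexed by l the Koszul flattening of degree n - 1 is then block diagonal and invertible.
   For x of rank >= 2 such forms vanishing at x exist; for x of rank 1 one must allow a
   single dependent n-subset of the g_l, which costs corank n only.  As a rank-one tensor
   contributes at most binom(2n-2, n-1) to the rank, this gives r - 1 >= 2n^2 - n as soon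
   as n < binom(2n-2, n-1), i.e. for n >= 3.

   For n = 2 (border apolarity, after Conner, Harper and Landsberg): if r <= 6, a limit E
   of spans of six simple tensors u_t v_t is a 6-dimensional subspace of A (x) B containing
   M_<2>(C^* ), and both E (x) A -> Lambda^2 A (x) B and E (x) B -> A (x) Lambda^2 B have
   rank <= 6 * 3.  Passing to leading terms for a generic torus, E becomes
   M_<2>(C^* ) plus two weight vectors; in each of the 66 cases one of the two ranks is
   at least 19.  Limits are taken along a fixed ultrafilter on the integers. *)

Module BorderRank.

From mathcomp Require Import all_boot all_order all_algebra perm spectral.
From mathcomp Require Import ring zify.
Set Implicit Arguments. Unset Strict Implicit. Unset Printing Implicit Defensive.
Import Order.TTheory GRing.Theory Num.Theory.
Local Open Scope ring_scope.

(** * Matrices over finite types and Koszul flattenings *)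

Definition fmx (F : fieldType) (S T : finType) (f : S -> T -> F) : 'M[F]_(#|S|, #|T|) :=
  \matrix_(i, j) f (enum_val i) (enum_val j).

Section FunctionMatrices.
Variable F : fieldType.
Implicit Types S T D : finType.

Lemma sum_enum_val S (f : S -> F) : \sum_(i < #|S|) f (enum_val i) = \sum_s f s.
Proof. by rewrite [RHS](reindex _ (onW_bij _ (enum_val_bij S))). Qed.

Lemma mul_fmx S T D (f : S -> D -> F) (g : D -> T -> F) :
  fmx f *m fmx g = fmx (fun s t => \sum_d f s d * g d t).
Proof.
apply/matrixP => i j; rewrite !mxE -(@sum_enum_val D).
by apply: eq_bigr => d _; rewrite !mxE.
Qed.

Lemma eq_fmx S T (f g : S -> T -> F) : f =2 g -> fmx f = fmx g.
Proof. by move=> fg; apply/matrixP => i j; rewrite !mxE fg. Qed.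

Lemma rank_fmx_factor S T D (f : S -> T -> F) (a : S -> D -> F) (b : D -> T -> F) :
  (forall s t, f s t = \sum_d a s d * b d t) -> (\rank (fmx f) <= #|D|)%N.
Proof.
move=> /eq_fmx ->; rewrite -mul_fmx.
by apply: leq_trans (mxrankM_maxl _ _) _; exact: rank_leq_col.
Qed.

Lemma rank_fmx_sum S T (I : finType) (f : I -> S -> T -> F) (d : nat) :
  (forall i, (\rank (fmx (f i)) <= d)%N) ->
  (\rank (fmx (fun x y => \sum_i f i x y)%R) <= #|I| * d)%N.
Proof.
move=> fd; have -> : #|I| = size (index_enum I) by rewrite /index_enum -enumT -cardE.
elim: (index_enum I) => [|i s ih].
  rewrite (_ : fmx _ = 0) ?mxrank0//; apply/matrixP => x y.
  by rewrite !mxE big_nil.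
rewrite (_ : fmx _ = fmx (f i) + fmx (fun x y => \sum_(i <- s) f i x y)); last first.
  by apply/matrixP => x y; rewrite !mxE big_cons.
by apply: leq_trans (mxrank_add _ _) _; rewrite mulSn leq_add.
Qed.

Lemma rank_fmx_reindex S T p q (f : S -> T -> F) (a : 'I_p -> S) (b : 'I_q -> T) :
  (\rank (\matrix_(i, j) f (a i) (b j))%R <= \rank (fmx f))%N.
Proof.
rewrite (_ : \matrix_(i, j) _ = (\matrix_(i, j) (a i == enum_val j)%:R) *m fmx f *m
   (\matrix_(i, j) (enum_val i == b j)%:R)).
  by apply: leq_trans (mxrankM_maxl _ _) _; exact: mxrankM_maxr.
apply/matrixP => i j; rewrite !mxE.
under eq_bigr => t _.
  rewrite !mxE; under eq_bigr => s _ do rewrite !mxE.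
  rewrite (sum_enum_val (fun s => (a i == s)%:R * f s (enum_val t))).
  rewrite (bigD1 (a i))//= eqxx mul1r big1 => [|s]; last first.
    by rewrite eq_sym => /negPf ->; rewrite mul0r.
  rewrite addr0; over.
rewrite (sum_enum_val (fun t => f (a i) t * (t == b j)%:R)).
rewrite (bigD1 (b j))//= eqxx mulr1 big1 ?addr0// => s /negPf ->.
by rewrite mulr0.
Qed.

(** The hypothesis says that the rows of [f] in [P], lengthened by the columns of [q], are
    independent; dropping those #|D| columns costs at most #|D| in rank. *)
Lemma rank_fmx_ge S T D (P : {set S}) (f : S -> T -> F) (q : S -> D -> F) :
  (forall v : S -> F, (forall s, s \notin P -> v s = 0) ->
     (forall t, \sum_s v s * f s t = 0) -> (forall d, \sum_s v s * q s d = 0) ->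
     forall s, v s = 0) ->
  (#|P| <= \rank (fmx f) + #|D|)%N.
Proof.
move=> inj.
pose A := row_mx (\matrix_(i < #|P|, j < #|T|) f (enum_val i) (enum_val j))
                 (\matrix_(i < #|P|, j < #|D|) q (enum_val i) (enum_val j)).
have Afree : row_free A.
  apply: inj_row_free => v; rewrite mul_mx_row -row_mx0 => /eq_row_mx[vf vq].
  pose v' s := \sum_(i < #|P| | enum_val i == s) v 0 i.
  have sumv' (g : S -> F) : \sum_s v' s * g s = \sum_(i < #|P|) v 0 i * g (enum_val i).
    rewrite (partition_big (fun i : 'I_#|P| => enum_val i) predT)//=.
    by apply: eq_bigr => s _; rewrite mulr_suml; apply: eq_bigr => i /eqP ->.
  have v'0 : forall s, v' s = 0.
    apply: inj => [s sP|t|d].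
    - by rewrite /v' big1// => i /eqP si; move: sP; rewrite -si enum_valP.
    - rewrite sumv'; move/matrixP: vf => /(_ 0 (enum_rank t)); rewrite !mxE => vf.
      by rewrite -[RHS]vf; apply: eq_bigr => i _; rewrite !mxE enum_rankK.
    - rewrite sumv'; move/matrixP: vq => /(_ 0 (enum_rank d)); rewrite !mxE => vq.
      by rewrite -[RHS]vq; apply: eq_bigr => i _; rewrite !mxE enum_rankK.
  apply/rowP => i; rewrite [RHS]mxE -[RHS](v'0 (enum_val i)) /v'.
  by rewrite (big_pred1 i)// => j /=; rewrite (inj_eq enum_val_inj).
move: Afree; rewrite /row_free => /eqP <-.
rewrite -mxrank_tr tr_row_mx -addsmxE.
apply: leq_trans (mxrank_adds_leqif _ _) _; rewrite !mxrank_tr leq_add ?rank_leq_col//.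
exact: (rank_fmx_reindex f (fun i : 'I_#|P| => enum_val i) (fun j : 'I_#|T| => enum_val j)).
Qed.

End FunctionMatrices.

(** * Exterior multiplication by a vector and Koszul flattenings *)

Section Exterior.
Variables (F : numFieldType) (N : nat).
Implicit Types (I J : {set 'I_N}) (l : 'I_N) (a : 'I_N -> F).

Definition ext_sign I l : F := (-1) ^+ #|[set i in I | (i < l)%N]|.

(* The matrix of [a /\ _] in the basis [e_I] of the exterior algebra of F^N. *)
Definition wedge a I J : F :=
  \sum_(l | l \notin I) (J == l |: I)%:R * (ext_sign I l * a l).

Lemma ext_sign_neq0 I l : ext_sign I l != 0.
Proof. by rewrite signr_eq0. Qed.

Lemma ext_signU1 I l l' : l \notin I ->
  ext_sign (l |: I) l' = (-1) ^+ (l < l')%N * ext_sign I l'.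
Proof.
move=> lI; rewrite /ext_sign -exprD; congr (_ ^+ _).
case: (ltnP l l') => ll'.
  rewrite (_ : [set i in l |: I | (i < l')%N] = l |: [set i in I | (i < l')%N]).
    by rewrite cardsU1 inE (negPf lI).
  by apply/setP => i; rewrite !inE andb_orl; case: eqP => //= ->; rewrite ll'.
apply: eq_card => i; rewrite !inE; case: (eqVneq i l) => //= ->.
by rewrite (negPf lI) ltnNge ll'.
Qed.

Lemma wedgeU1 a I l : l \notin I -> wedge a I (l |: I) = ext_sign I l * a l.
Proof.
move=> lI; rewrite /wedge (bigD1 l)//= eqxx mul1r big1 ?addr0// => l' /andP[l'I ll'].
case: eqP => [/setP /(_ l')|]; last by rewrite mul0r.
by rewrite !inE eqxx (negPf ll') (negPf l'I).
Qed.

(** This is a /\ a = 0: inserting l then l', or l' then l, reaches the same set with opposite signs,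
    so the sum equals its own negative. *)
Lemma wedge_wedge a I J : \sum_K wedge a I K * wedge a K J = 0.
Proof.
pose f l l' : F := (l \notin I)%:R * (l' \notin l |: I)%:R * (J == l' |: (l |: I))%:R *
  (ext_sign I l * a l * (ext_sign (l |: I) l' * a l')).
have -> : \sum_K wedge a I K * wedge a K J = \sum_l \sum_l' f l l'.
  under eq_bigr => K _ do rewrite /wedge mulr_suml.
  rewrite exchange_big /= big_mkcond /=; apply: eq_bigr => l _.
  rewrite /f; case: (boolP (l \notin I)) => lI; last first.
    by rewrite big1// => l' _; rewrite !mul0r.
  rewrite (bigD1 (l |: I))//= eqxx [X in _ + X]big1 ?addr0; last first.
    by move=> K /negPf ->; rewrite !mul0r.
  rewrite mul1r mulr_sumr big_mkcond /=; apply: eq_bigr => l' _.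
  case: (l' \notin _) => /=; ring.
have fA l l' : f l l' = - f l' l.
  rewrite /f !inE !negb_or setUCA.
  case: (boolP (l \notin I)) => lI; last by rewrite !(mul0r, andbF, oppr0, mulr0).
  case: (boolP (l' \notin I)) => lI'; last by rewrite !(mul0r, andbF, oppr0, mulr0).
  rewrite !ext_signU1// (eq_sym l l'); case: (ltngtP l l') => // [ll'|ll'|/val_inj ->].
  - by rewrite (_ : l' == l = false) /=; [ring | apply/eqP => e; rewrite e ltnn in ll'].
  - by rewrite (_ : l' == l = false) /=; [ring | apply/eqP => e; rewrite e ltnn in ll'].
  - by rewrite eqxx !(mul0r, mulr0, oppr0).
set s := (\sum_l _); have : s = - s.
  by rewrite {1}/s exchange_big /= -sumrN; apply: eq_bigr => l _; rewrite -sumrN; apply: eq_bigr.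
by move/eqP; rewrite -addr_eq0 -mulr2n mulrn_eq0 /= => /eqP.
Qed.

Lemma card_draws_avoid (m : nat) l :
  #|[set I : {set 'I_N} | (#|I| == m) && (l \notin I)]| = 'C(N.-1, m).
Proof.
rewrite -[in RHS](card_ord N) -(cardsC1 l) -cards_draws.
by apply: eq_card => I; rewrite !inE andbC -disjoints_subset disjoint_sym disjoints1.
Qed.

(* Koszul flattening of a tensor in F^N (x) F^B (x) F^C, restricted to degree m. *)
Definition koszul (B C : finType) (m : nat) (S : 'I_N -> B -> C -> F)
    (x : {set 'I_N} * B) (y : {set 'I_N} * C) : F :=
  (#|x.1| == m)%:R * wedge (fun l => S l x.2 y.2) x.1 y.1.

Lemma koszul_sum (B C : finType) (m r : nat) (S : 'I_r -> 'I_N -> B -> C -> F) x y :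
  koszul m (fun l b c => \sum_t S t l b c) x y = \sum_t koszul m (S t) x y.
Proof.
rewrite /koszul -[RHS]mulr_sumr; congr (_ * _); rewrite /wedge exchange_big /=.
by apply: eq_bigr => l _; rewrite !mulr_sumr.
Qed.

(* If [a l0 <> 0] then the rows of [wedge a] avoiding [l0] span the row space, by [a /\ a = 0]. *)
Lemma rank_koszul_simple (B C : finType) (m : nat) (a : 'I_N -> F) (v : B -> F) (w : C -> F) :
  (\rank (fmx (koszul m (fun l b c => a l * v b * w c)%R)) <= 'C(N.-1, m))%N.
Proof.
have kE x y : koszul m (fun l b c => a l * v b * w c) x y =
    (#|x.1| == m)%:R * (v x.2 * w y.2 * wedge a x.1 y.1).
  by rewrite /koszul /wedge !mulr_sumr; apply: eq_bigr => l _; ring.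
case: (pickP (fun l => a l != 0)) => [l0 al0|a0]; last first.
  rewrite (_ : fmx _ = 0) ?mxrank0//; apply/matrixP => i j; rewrite !mxE kE.
  rewrite [wedge _ _ _]big1 ?mulr0// => l _.
  by move/negbFE: (a0 l) => /eqP ->; rewrite !mulr0.
pose P := [set I : {set 'I_N} | (#|I| == m) && (l0 \notin I)].
(* For [l0 \in I] the relation [wedge_wedge] at [I :\ l0] is solved for row [I], whose coefficient
   there is [a l0] up to sign. *)
pose c (I I' : {set 'I_N}) : F := if l0 \in I
  then - (wedge a (I :\ l0) I' / wedge a (I :\ l0) I) else (I == I')%:R.
have wc I J : #|I| = m -> wedge a I J = \sum_(I' in P) c I I' * wedge a I' J.
  move=> Im; rewrite /c; case: (boolP (l0 \in I)) => l0I; last first.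
    have IP : I \in P by rewrite inE Im eqxx.
    rewrite (bigD1 I)//= eqxx mul1r big1 ?addr0// => I' /andP[_].
    by rewrite eq_sym => /negPf ->; rewrite mul0r.
  have l0I0 : l0 \notin I :\ l0 by rewrite !inE eqxx.
  have wI : wedge a (I :\ l0) I != 0.
    by rewrite -[X in wedge _ _ X](setD1K l0I) wedgeU1// mulf_neq0// ext_sign_neq0.
  have := wedge_wedge a (I :\ l0) J; rewrite (bigD1 I)//=.
  move/(canRL (addrK _)); rewrite sub0r => h.
  apply: (mulfI wI); rewrite h mulr_sumr big_mkcond [in RHS]big_mkcond -sumrN.
  apply: eq_bigr => I' _; case: ifPn => I'I; last first.
    by rewrite negbK in I'I; rewrite (eqP I'I) inE l0I andbF oppr0.
  case: ifPn => [_|I'P]; first by field.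
  (* A nonzero term outside [P] would come from a set [l |: (I :\ l0)] containing [l0], that is,
     from [I] itself. *)
  suff -> : wedge a (I :\ l0) I' = 0 by rewrite mul0r oppr0.
  rewrite /wedge big1// => l lI0; case: eqP => [I'E|_]; last by rewrite mul0r.
  move: I'P; rewrite inE I'E cardsU1 lI0 -Im (cardsD1 l0 I) l0I eqxx /= negbK.
  rewrite in_setU1 (negPf l0I0) orbF => /eqP l0l.
  by move: I'I; rewrite I'E -l0l setD1K// eqxx.
pose D : finType := {I | I \in P}.
have <- : #|D| = 'C(N.-1, m) by rewrite card_sig -(card_draws_avoid m l0).
apply: (@rank_fmx_factor _ _ _ D _
  (fun (x : {set 'I_N} * B) d => (#|x.1| == m)%:R * (v x.2 * c x.1 (val d)))
                           (fun d (y : {set 'I_N} * C) => w y.2 * wedge a (val d) y.1)) => x y.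
rewrite kE; case: eqP => [xm|_]; last by rewrite mul0r big1// => d _; rewrite !mul0r.
rewrite wc// !mulr_sumr (reindex_omap (val : D -> _) insub) /=; last first.
  by move=> I IP; rewrite insubT.
rewrite (eq_bigl predT) => [|d]; last by rewrite (valP d) valK eqxx.
by apply: eq_bigr => d _; ring.
Qed.

End Exterior.

Lemma sum_pair (V : nmodType) (S T : finType) (f : S * T -> V) :
  \sum_p f p = \sum_s \sum_t f (s, t).
Proof. by rewrite pair_bigA /=; apply: eq_bigr => -[]. Qed.

(** * Corank of the Koszul flattening of projected matrix multiplication *)

Section GeneralPosition.
Variable F : numFieldType.

(* Any n of the vectors [h l] are independent; any n of the vectors [g l] are,
   except those in J0, whose only linear relation involves l0. *)
Definition general_position n N (h : 'I_N -> 'I_n -> F) : Prop :=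
  forall (v : 'I_n -> F) (L : {set 'I_N}), #|L| = n ->
    (forall l, l \in L -> \sum_j v j * h l j = 0) -> forall j, v j = 0.

Definition almost_general_position n N (J0 : {set 'I_N}) (l0 : 'I_N)
    (g : 'I_N -> 'I_n -> F) : Prop :=
  forall (e : 'I_N -> F) (J : {set 'I_N}), #|J| = n -> (J = J0 -> e l0 = 0) ->
    (forall i, \sum_(l in J) e l * g l i = 0) -> forall l, l \in J -> e l = 0.

(** The tensor is the image of M_<n> under X |-> (g_l^T X h_l)_l. For [v] in the left kernel, column
    [J] is a relation among the n vectors [g l], [l \in J], with coefficients [c (J :\ l) l w] up to
    sign, so these vanish; then [v] at [I] is orthogonal to the n vectors [h l], [l \notin I], hence
    zero. Only [J0] may fail, at the cost of n extra equations. *)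
Lemma koszul_rank_ge (m : nat) (g h : 'I_(m + m).+1 -> 'I_m.+1 -> F)
    (J0 : {set 'I_(m + m).+1}) (l0 : 'I_(m + m).+1) :
  l0 \in J0 -> #|J0| = m.+1 -> general_position h -> almost_general_position J0 l0 g ->
  ('C((m + m).+1, m) * (m.+1 * m.+1) <=
    \rank (fmx (koszul m (fun l (b c : 'I_m.+1 * 'I_m.+1) =>
      h l b.1 * g l c.2 * (b.2 == c.1)%:R)%R)) + m.+1)%N.
Proof.
set N := (m + m).+1; set n := m.+1 => l0J0 J0n gh gg.
set f := koszul _ _.
pose P := [set s : {set 'I_N} * ('I_n * 'I_n) | #|s.1| == m].
have cardP : #|P| = ('C(N, m) * (n * n))%N.
  rewrite (_ : P = setX [set I : {set 'I_N} | #|I| == m] setT).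
    by rewrite cardsX card_draws cardsT card_prod !card_ord.
  by apply/setP => s; rewrite !inE andbT.
rewrite -{}cardP -[X in (_ + X)%N](card_ord n).
pose I0 := J0 :\ l0.
(* The extra equations say [c I0 l0 w = 0] for each [w], which is what [almost_general_position]
   asks for at [J0]. *)
apply: (@rank_fmx_ge _ _ _ _ P f (fun s (w : 'I_n) =>
  (s.1 == I0)%:R * (s.2.2 == w)%:R * h l0 s.2.1)) => v vP vf vq.
pose c (I : {set 'I_N}) (l : 'I_N) (w : 'I_n) : F := \sum_j v (I, (j, w)) * h l j.
have Jeq (J : {set 'I_N}) (w i : 'I_n) : #|J| = n ->
    \sum_(l in J) ext_sign F (J :\ l) l * c (J :\ l) l w * g l i = 0.
  move=> Jn; rewrite -[RHS](vf (J, (w, i))) /f /koszul /wedge /=.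
  transitivity (\sum_(I : {set 'I_N}) \sum_l (l \notin I)%:R * (J == l |: I)%:R * (#|I| == m)%:R *
     (ext_sign F I l * c I l w * g l i)).
    rewrite exchange_big big_mkcond /=; apply: eq_bigr => l _; case: ifPn => lJ.
      rewrite (bigD1 (J :\ l))//= setD1K// !inE !eqxx /= [X in _ + X]big1 ?addr0.
        have : #|J :\ l| == m by have := cardsD1 l J; rewrite lJ Jn add1n => -[<-].
        by move=> ->; rewrite !mul1r.
      move=> I IJ; case: (boolP (l \notin I)) => lI; last by rewrite !mul0r.
      case: eqP => [JE|]; last by rewrite !(mulr0, mul0r).
      by move: IJ; rewrite JE setU1K// eqxx.
    rewrite big1// => I _; case: eqP => [JE|]; last by rewrite !(mulr0, mul0r).
    by move: lJ; rewrite JE setU11.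
  rewrite [RHS]sum_pair; apply: eq_bigr => I _ /=.
  under [RHS]eq_bigr => s _ do rewrite !mulr_sumr.
  rewrite [RHS]exchange_big [LHS]big_mkcond [RHS]big_mkcond /=; apply: eq_bigr => l _.
  case: ifPn => lI; last by rewrite !mul0r.
  rewrite [RHS]sum_pair /c !(mulr_sumr, mulr_suml); apply: eq_bigr => j _.
  rewrite (bigD1 w)//= eqxx [X in _ + X]big1 ?addr0 => [|w' /negPf ->]; last by rewrite !mulr0.
  by rewrite /=; (rewrite (_ : true%:R = 1 :> F)//; ring).
have c0 w : c I0 l0 w = 0.
  rewrite -[RHS](vq w).
  rewrite [RHS]sum_pair (bigD1 I0)//= [X in _ + X]big1 ?addr0; last first.
    by move=> I /negPf ->; rewrite big1// => s _; rewrite !mul0r mulr0.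
  rewrite [RHS]sum_pair; apply: eq_bigr => j _; rewrite (bigD1 w)//= !eqxx [X in _ + X]big1 ?addr0.
    by rewrite !mul1r.
  by move=> w' /negPf ->; rewrite mulr0 mul0r mulr0.
have call (I : {set 'I_N}) (l : 'I_N) (w : 'I_n) : #|I| = m -> l \notin I -> c I l w = 0.
  move=> Im lI; pose J := l |: I; have Jn : #|J| = n by rewrite cardsU1 lI Im.
  pose e l := ext_sign F (J :\ l) l * c (J :\ l) l w.
  have eJ0 : J = J0 -> e l0 = 0 by rewrite /e => ->; rewrite -/I0 c0 mulr0.
  have /eqP := gg e J Jn eJ0 (fun i => Jeq J w i Jn) l (setU11 _ _).
  rewrite /e setU1K//.
  by rewrite mulf_eq0 (negPf (ext_sign_neq0 _ _ _)) /= => /eqP.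
move=> [I [j w]]; case: (boolP ((I, (j, w)) \in P)) => [|/vP//].
rewrite inE /= => /eqP Im.
apply: (gh (fun j => v (I, (j, w))) (~: I)).
  by rewrite cardsCs setCK card_ord Im /N subSn ?leq_addr// addKn.
by move=> l; rewrite inE => lI; rewrite -[RHS](call I l w).
Qed.

End GeneralPosition.

(** * Forms annihilating a given matrix *)

Section Nodes.
Variables (F : numFieldType) (N : nat).
Implicit Types (J : {set 'I_N}) (l : 'I_N) (e : 'I_N -> F) (p : {poly F}).

(** The vectors g_l and h_l will be values of polynomials at these distinct points, so that
    independence becomes a count of roots. *)
Definition node l : F := (l : nat)%:R.

Definition node_poly J : {poly F} := \prod_(l in J) ('X - (node l)%:P).

Lemma node_inj : injective node.
Proof. by move=> l l' /eqP; rewrite eqr_nat => /eqP /val_inj. Qed.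

Lemma node_polyE J : node_poly J = \prod_(a <- [seq node l | l <- enum J]) ('X - a%:P).
Proof. by rewrite big_map big_enum. Qed.

Lemma size_node_poly J : size (node_poly J) = #|J|.+1.
Proof. by rewrite node_polyE size_prod_XsubC size_map -cardE. Qed.

Lemma monic_node_poly J : node_poly J \is monic.
Proof. exact: monic_prod_XsubC. Qed.

Lemma root_node_poly J l : ((node_poly J).[node l] == 0) = (l \in J).
Proof.
rewrite -[_ == 0]/(root _ _) node_polyE root_prod_XsubC mem_map ?mem_enum//.
exact: node_inj.
Qed.

Lemma poly_eq0_nodes p J : (size p <= #|J|)%N -> (forall l, l \in J -> p.[node l] = 0) -> p = 0.
Proof.
move=> pJ p0; apply/eqP; apply: contraTT pJ => p_neq0; rewrite -ltnNge.
have := max_poly_roots p_neq0 (rs := [seq node l | l <- enum J]).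
rewrite size_map -cardE; apply; last by rewrite map_inj_uniq ?enum_uniq//; exact: node_inj.
by apply/allP => a /mapP[l]; rewrite mem_enum => /p0 pl ->; exact/eqP.
Qed.

Lemma functional_eq0_nodes e J p l : l \in J -> p.[node l] != 0 ->
  (forall l', l' \in J -> l' != l -> e l' * p.[node l'] = 0) ->
  \sum_(l' in J) e l' * p.[node l'] = 0 -> e l = 0.
Proof.
move=> lJ pl p0; rewrite (bigD1 l)//= big1 ?addr0 => [|l' /andP[]]; last exact: p0.
by move/eqP; rewrite mulf_eq0 (negPf pl) orbF => /eqP.
Qed.

Lemma functional_poly e J k : (forall i, (i < k)%N -> \sum_(l in J) e l * node l ^+ i = 0) ->
  forall p, (size p <= k)%N -> \sum_(l in J) e l * p.[node l] = 0.
Proof.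
move=> e0 p pk; under eq_bigr => l _ do rewrite (horner_coef_wide _ pk) mulr_sumr.
rewrite exchange_big big1//= => i _.
transitivity (p`_i * \sum_(l in J) e l * node l ^+ i); last by rewrite e0 ?mulr0.
by rewrite mulr_sumr; apply: eq_bigr => l _; ring.
Qed.

(** The sets [J0 :\: J] and [J :\: J0] are equinumerous, the first lying below n and the second not.
    Strictness keeps a test polynomial of [forms_rank1] nonzero at its node. *)
Lemma sum_first_nodes n J J0 : J0 = [set l : 'I_N | (l < n)%N] -> #|J| = #|J0| -> J != J0 ->
  (\sum_(l in J0) (l : nat) < \sum_(l in J) (l : nat))%N.
Proof.
move=> J0E cJ nJ.
rewrite (big_setID J) [X in (_ < X)%N](big_setID J0) /= setIC ltn_add2l.
have cD : #|J :\: J0| = #|J0 :\: J|.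
  by have := cardsID J0 J; have := cardsID J J0; rewrite (setIC J0) cJ; lia.
have D0 : (0 < #|J0 :\: J|)%N.
  rewrite card_gt0; apply: contraNneq nJ => /eqP; rewrite setD_eq0 => sJ.
  by rewrite eq_sym eqEcard sJ cJ /=.
apply: (@leq_ltn_trans (\sum_(l in J0 :\: J) n.-1));
  last apply: (@leq_trans (\sum_(l in J :\: J0) n)).
- by apply: leq_sum => l; rewrite J0E !inE => /andP[_]; lia.
- rewrite !sum_nat_const cD ltn_pmul2l//.
  by have /card_gt0P[l] := D0; rewrite J0E !inE; lia.
- by apply: leq_sum => l; rewrite J0E !inE -leqNgt => /andP[].
Qed.

End Nodes.
Arguments node {F N}.
Arguments node_poly {F N}.

Section AnnihilatingForms.
Variable F : numFieldType.

Lemma card_ord_lt m : #|[set l : 'I_(m + m).+1 | (l < m.+1)%N]| = m.+1.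
Proof.
have le : (m.+1 <= (m + m).+1)%N by rewrite ltnS leq_addr.
by rewrite -sum1dep_card -(big_ord_widen _ (fun=> 1%N) le) sum1_card card_ord.
Qed.

(* Here [g l i * h l i = c i * node l ^+ m] with nonzero [c i] summing to 0 over i < rho. *)
Lemma forms_rank_ge2 m (rho : nat) : (1 < rho <= m.+1)%N ->
  exists (g h : 'I_(m + m).+1 -> 'I_m.+1 -> F), [/\ general_position h,
    (forall J0 l0, almost_general_position J0 l0 g) &
    forall l, \sum_(i < m.+1 | (i < rho)%N) g l i * h l i = 0].
Proof.
move=> /andP[rho1 rhon].
(* The entry at 0 balances the [rho - 1] ones; it is nonzero because [rho > 1]. *)
pose c (i : nat) : F := if i == 0%N then 1 - rho%:R else 1.
have c_neq0 i : c i != 0.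
  rewrite /c; case: ifP => _; rewrite ?oner_eq0// subr_eq0 eq_sym pnatr_eq1; lia.
exists (fun l i => node l ^+ (m - i)), (fun l i => c i * node l ^+ i); split.
- move=> v L Ln v0 j.
  have : \poly_(i < m.+1) (v (inord i) * c i) = 0.
    apply: (@poly_eq0_nodes F _ _ L); first by rewrite Ln size_poly.
    move=> l lL; rewrite horner_poly -[RHS](v0 l lL).
    by apply: eq_bigr => i _; rewrite inord_val mulrA.
  move/polyP => /(_ j); rewrite coef_poly ltn_ord coef0 inord_val => /eqP.
  by rewrite mulf_eq0 (negPf (c_neq0 j)) orbF => /eqP.
- move=> J0 l0 e J Jn _ e0 l lJ.
  have ep : forall p : {poly F}, (size p <= m.+1)%N -> \sum_(l in J) e l * p.[node l] = 0.
    apply: functional_poly => i im; have := e0 (inord (m - i)).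
    by rewrite inordK ?subKn// ltnS leq_subr.
  apply: (functional_eq0_nodes (p := node_poly (J :\ l)) lJ).
  - by rewrite root_node_poly !inE eqxx.
  - move=> l' l'J ll'; apply/eqP; rewrite mulf_eq0 root_node_poly !inE ll' l'J.
    by rewrite orbT.
  - by apply: ep; rewrite size_node_poly; have := cardsD1 l J; rewrite lJ Jn; lia.
- move=> l.
  under eq_bigr => i _.
    rewrite mulrCA -exprD subnK -1?ltnS//; over.
  rewrite -mulr_suml -(big_ord_widen _ c rhon).
  case: rho rho1 @c {c_neq0 rhon} => // rho _ /=.
  rewrite big_ord_recl /= sumr_const card_ord -natr1.
  by rewrite [X in X * _](_ : _ = 0) ?mul0r//; ring.
Qed.


(* When x has rank 1 the products [g l 0 * h l 0] must vanish; since g and h can each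
   kill n - 1 nodes only, one is forced to allow a single dependent n-subset J0 of g. *)
Lemma forms_rank1 m : (0 < m)%N ->
  exists (g h : 'I_(m + m).+1 -> 'I_m.+1 -> F) (J0 : {set 'I_(m + m).+1}) l0,
    [/\ general_position h, #|J0| = m.+1, l0 \in J0,
    almost_general_position J0 l0 g & forall l, g l ord0 * h l ord0 = 0].
Proof.
move=> m_gt0; pose N := (m + m).+1.
pose J0 := [set l : 'I_N | (l < m.+1)%N].
have J0n : #|J0| = m.+1 := card_ord_lt m.
(* G H vanishes at every node. H has degree m and completes 1, ..., t^(m-1) to a basis of the
   polynomials of degree at most m; G has degree m + 1, so the [g] side misses t^m. *)
pose G := node_poly J0 : {poly F}; pose H := node_poly (~: J0) : {poly F}.
have sH : size H = m.+1 by rewrite size_node_poly cardsCs setCK card_ord J0n subSS addnK.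
exists (fun l i => if i == ord0 then G.[node l] else node l ^+ i.-1).
exists (fun l i => if i == ord0 then H.[node l] else node l ^+ i.-1).
exists J0, ord0; split=> //; last 1 first.
- move=> l; rewrite eqxx; apply/eqP; rewrite mulf_eq0 !root_node_poly in_setC.
  exact: orbN.
- move=> v L Ln v0.
  pose q := \poly_(i < m) v (inord i.+1).
  have p0 : v ord0 *: H + q = 0.
    apply: (@poly_eq0_nodes F N _ L) => [|l lL].
      rewrite Ln (leq_trans (size_polyD _ _))// geq_max (leq_trans (size_scale_leq _ _)) ?sH//.
      by rewrite (leq_trans (size_poly _ _)).
    rewrite !hornerE -[RHS](v0 l lL) big_ord_recl eqxx horner_poly; congr (_ + _).
    apply: eq_bigr => i _; congr (v _ * _); apply/val_inj.
    by rewrite /= inordK// ltnS.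
  have v00 : v ord0 = 0.
    move/polyP: p0 => /(_ m); rewrite coefD coefZ coef_poly ltnn addr0 coef0.
    have /monicP := monic_node_poly F (~: J0); rewrite lead_coefE -/H sH => ->.
    by rewrite mulr1.
  move=> j; case: (unliftP ord0 j) => [i ->|->//].
  move: p0; rewrite v00 scale0r add0r => /polyP /(_ i).
  rewrite coef_poly ltn_ord coef0 => vi; rewrite -[RHS]vi; congr v.
  by apply/val_inj; rewrite /= inordK// ltnS.
- by rewrite inE.
- move=> e J Jn J0e e0 l lJ.
  have eG : \sum_(l in J) e l * G.[node l] = 0 by rewrite -[RHS](e0 ord0).
  have ep : forall p : {poly F}, (size p <= m)%N -> \sum_(l in J) e l * p.[node l] = 0.
    apply: functional_poly => i im; rewrite -[RHS](e0 (inord i.+1)).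
    by apply: eq_bigr => l' _; rewrite -val_eqE /= inordK.
  have [JJ0|JJ0] := eqVneq J J0.
    (* G vanishes on [J0], leaving only test polynomials of degree below m; since [e] vanishes at
       [ord0], just m nodes remain and these suffice. *)
    have el0 := J0e JJ0; case: (eqVneq l ord0) => [->//|ll0].
    have l0J : ord0 \in J by rewrite JJ0 inE.
    apply: (functional_eq0_nodes (p := node_poly (J :\ ord0 :\ l)) lJ).
    + by rewrite root_node_poly !inE eqxx.
    + move=> l' l'J ll'; case: (eqVneq l' ord0) => [->|l'0]; first by rewrite el0 mul0r.
      by apply/eqP; rewrite mulf_eq0 root_node_poly !inE ll' l'J l'0 orbT.
    + apply: ep; rewrite size_node_poly.
      have := cardsD1 ord0 J; rewrite l0J (cardsD1 l (J :\ ord0)) !inE ll0 lJ Jn /=; lia.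
  (* The extra root [c] gives p and G the same sum of roots, so p - G has degree below m and p is an
     admissible test polynomial. It is nonzero at [l] exactly when J and J0 have different node
     sums. *)
  pose c : F := \sum_(l' in J0) node l' - \sum_(l' in J :\ l) node l'.
  pose p : {poly F} := node_poly (J :\ l) * ('X - c%:P).
  have cJl : #|J :\ l| = m by have := cardsD1 l J; rewrite lJ Jn; lia.
  have pmon : p \is monic by rewrite monicMl ?monic_node_poly// monicXsubC.
  have sp : size p = m.+2.
    by rewrite size_monicM ?monic_node_poly ?polyXsubC_eq0// size_node_poly size_XsubC cJl addnC.
  have sG : size G = m.+2 by rewrite size_node_poly J0n.
  have pG : (size (p - G)%R <= m)%N.
    apply/leq_sizeP => i mi; rewrite coefB.
    have [i2|] := leqP m.+2 i; first by rewrite !nth_default ?subrr// ?sp ?sG.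
    rewrite ltnS leq_eqVlt => /orP[/eqP ->|im].
      have /monicP := pmon; have /monicP := monic_node_poly F J0.
      by rewrite !lead_coefE -/G sp sG /= => -> ->; rewrite subrr.
    have -> : i = m by apply/eqP; rewrite eqn_leq mi andbT -ltnS.
    have -> : p`_m = - \sum_(l' in J0) node l'.
      have -> : p = \prod_(a <- c :: [seq node l' | l' <- enum (J :\ l)]) ('X - a%:P).
        by rewrite big_cons mulrC -node_polyE.
      have := @coefPn_prod_XsubC _ (c :: [seq node l' | l' <- enum (J :\ l)]).
      rewrite /= size_map -cardE cJl => ->//; congr (- _).
      by rewrite big_cons big_map big_enum /= /c subrK.
    have := @coefPn_prod_XsubC _ [seq node l' | l' <- enum J0] : _ -> _ = _ :> F.
    rewrite size_map -cardE J0n -node_polyE -/G => ->//.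
    by rewrite big_map big_enum /= subrr.
  have pl : p.[node l] != 0.
    rewrite hornerM mulf_neq0 ?root_node_poly ?setD11// !hornerE subr_eq0 /c.
    rewrite eq_sym subr_eq -(big_setD1 l lJ) /= -!natr_sum eqr_nat.
    by rewrite ltn_eqF// (sum_first_nodes (n := m.+1))// Jn.
  apply: (functional_eq0_nodes lJ pl) => [l' l'J ll'|].
    by rewrite hornerM (_ : _.[_] = 0) ?mul0r ?mulr0//; apply/eqP; rewrite root_node_poly !inE ll'.
  have := ep _ pG; under eq_bigr do rewrite hornerD hornerN mulrBr.
  by rewrite sumrB eG subr0.
Qed.

(** In the rank normal form P E Q of x, with E diagonal with ones in the first [\rank x] places, the
    invertible changes of basis P and Q preserve general position, so it is enough to treat E: ranks
    1 and at least 2 are the two preceding constructions. *)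
Lemma annihilating_forms m (x : 'M[F]_m.+1) : (0 < m)%N -> x != 0 ->
  exists (g h : 'I_(m + m).+1 -> 'I_m.+1 -> F) (J0 : {set 'I_(m + m).+1}) l0,
    [/\ general_position h, #|J0| = m.+1, l0 \in J0,
    almost_general_position J0 l0 g &
    forall l, \sum_i \sum_j g l i * x i j * h l j = 0].
Proof.
move=> m_gt0 x_neq0; set n := m.+1; pose N := (m + m).+1.
have [g [h [J0 [l0 [gh J0n l0J0 gg gh0]]]]] : exists (g h : 'I_N -> 'I_n -> F) (J0 : {set 'I_N}) l0,
    [/\ general_position h, #|J0| = n, l0 \in J0, almost_general_position J0 l0 g &
    forall l, \sum_(i < n | (i < \rank x)%N) g l i * h l i = 0].
  have [r1|r1] := leqP (\rank x) 1; last first.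
    have [|g [h [gh gg gh0]]] := @forms_rank_ge2 m (\rank x); first by rewrite r1 rank_leq_row.
    exists g, h, [set l : 'I_N | (l < n)%N], ord0; split=> //; last by rewrite inE.
    exact: card_ord_lt.
  have [g [h [J0 [l0 [gh J0n l0J0 gg gh0]]]]] := forms_rank1 m_gt0.
  exists g, h, J0, l0; split=> // l; rewrite (big_pred1 ord0)// => i.
  have -> : \rank x = 1%N by apply/eqP; rewrite eqn_leq r1 lt0n mxrank_eq0.
  by rewrite ltnS leqn0.
pose P := col_ebase x; pose Q := row_ebase x.
have Pu : P \in unitmx by exact: col_ebase_unit.
have Qu : Q \in unitmx by exact: row_ebase_unit.
exists (fun l i => \sum_k g l k * invmx P k i), (fun l j => \sum_k invmx Q j k * h l k), J0, l0.
split=> //.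
- move=> v L Ln v0; pose w := (\row_j v j) *m invmx Q.
  have w0 : w = 0.
    apply/rowP => k; rewrite [RHS]mxE; apply: (gh (fun k => w 0 k) L Ln) => l lL.
    rewrite -[RHS](v0 l lL); under eq_bigr => j _ do rewrite mxE mulr_suml.
    rewrite exchange_big; apply: eq_bigr => j _; rewrite mulr_sumr; apply: eq_bigr => i _.
    by rewrite !mxE mulrA.
  have /rowP v_eq0 : \row_j v j = 0 by rewrite -(mulmxKV Qu (\row_j v j)) -/w w0 mul0mx.
  by move=> j; have := v_eq0 j; rewrite !mxE.
- move=> e J Jn eJ0 e0; apply: gg => // i.
  pose w := \row_k \sum_(l in J) e l * g l k.
  have wP : w *m invmx P = 0.
    apply/rowP => k; rewrite [RHS]mxE -[RHS](e0 k) mxE.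
    under eq_bigr => j _ do rewrite mxE mulr_suml.
    rewrite exchange_big; apply: eq_bigr => l _; rewrite mulr_sumr; apply: eq_bigr => j _.
    by rewrite mulrA.
  have /rowP w_eq0 : w = 0 by rewrite -(mulmxKV Pu w) wP mul0mx.
  by have := w_eq0 i; rewrite !mxE.
- move=> l; rewrite -[RHS](gh0 l).
  have -> : \sum_i \sum_j (\sum_k g l k * invmx P k i) * x i j * (\sum_k invmx Q j k * h l k) =
    ((\row_k g l k *m invmx P) *m x *m (invmx Q *m (\col_k h l k))) 0 0.
    rewrite mxE exchange_big /=; apply: eq_bigr => j _; rewrite !mxE mulr_suml.
    apply: eq_bigr => i _; rewrite !mxE; congr (_ * _ * _); apply: eq_bigr => k _.
    - by rewrite mxE.
    - by rewrite mxE.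
  rewrite -[x in LHS]mulmx_ebase -/P -/Q !mulmxA mulmxKV// mulmxK// mxE.
  rewrite [RHS]big_mkcond; apply: eq_bigr => j _; rewrite !mxE.
  rewrite (bigD1 j)//= big1 ?addr0 => [|i ij]; last first.
    by rewrite !mxE val_eqE (negPf ij) mulr0.
  by rewrite !mxE eqxx /=; case: ifP; rewrite ?mulr1 ?mulr0 ?mul0r.
Qed.

End AnnihilatingForms.

(** * Skew-symmetrization of a family of tensors *)

(* The map E (x) A -> Lambda^2 A (x) B, for a family X of tensors in A (x) B. *)
Definition skew (V : zmodType) (E A B : finType) (X : E -> A -> B -> V)
    (x : E * A) (y : A * A * B) : V :=
  (if x.2 == y.1.1 then X x.1 y.1.2 y.2 else 0) -
  (if x.2 == y.1.2 then X x.1 y.1.1 y.2 else 0).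

Section Skew.
Variable F : numFieldType.

(** For each e the combination of the rows (e, c) with coefficients [u e c] is u /\ u (x) v = 0, so
    one of these #|A| rows is redundant. *)
Lemma rank_skew_simple (E A B : finType) (u : E -> A -> F) (v : E -> B -> F) :
  (\rank (fmx (skew (fun e a b => u e a * v e b)%R)) <= #|E| * #|A|.-1)%N.
Proof.
pose f e (x : E * A) y := (x.1 == e)%:R * skew (fun e a b => u e a * v e b) x y.
have -> : fmx (skew (fun e a b => u e a * v e b)) =
    fmx (fun x y => \sum_e f e x y).
  apply: eq_fmx => x y; rewrite (bigD1 x.1)//= /f eqxx mul1r big1 ?addr0// => e.
  by rewrite eq_sym => /negPf ->; rewrite mul0r.
apply: rank_fmx_sum => e.
case: (pickP (fun a => u e a != 0)) => [p up|u0]; last first.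
  rewrite (_ : fmx _ = 0) ?mxrank0//; apply/matrixP => i j; rewrite !mxE /f.
  case: eqP => [ei|]; last by rewrite mul0r.
  have {}u0 a : u e a = 0 by move/negbFE: (u0 a) => /eqP.
  by rewrite /skew ei !u0 !mul0r !if_same subrr mulr0.
pose D : finType := {a : A | a \in [set~ p]}.
have <- : #|D| = #|A|.-1 by rewrite card_sig -(cardsC1 p).
apply: (@rank_fmx_factor _ _ _ D _
  (fun x d => (x.1 == e)%:R * (if x.2 == p then - (u e (val d) / u e p) else (x.2 == val d)%:R))
  (fun d y => skew (fun e a b => u e a * v e b) (e, val d) y)) => -[e' a] [[a1 a2] b].
rewrite /f /=; case: eqP => [->|_]; last by rewrite mul0r big1// => d _; rewrite !mul0r.
rewrite mul1r.
pose h c := (if a == p then - (u e c / u e p) else (a == c)%:R) *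
  skew (fun e a b => u e a * v e b) (e, c) (a1, a2, b).
transitivity (\sum_(c in [set~ p]) h c); last first.
  rewrite (reindex_omap (val : D -> _) insub) /=; last by move=> c cp; rewrite insubT.
  rewrite (eq_bigl predT) => [|d]; last by rewrite (valP d) valK eqxx.
  by apply: eq_bigr => d _; rewrite /h mul1r.
rewrite /h; case: eqVneq => [->|ap]; last first.
  rewrite (bigD1 a) ?inE//= eqxx mul1r big1 ?addr0// => c /andP[_].
  by rewrite eq_sym => /negPf ->; rewrite mul0r.
have sumA : \sum_c u e c * skew (fun e a b => u e a * v e b) (e, c) (a1, a2, b) = 0.
  rewrite /skew /=; under eq_bigr do rewrite mulrBr.
  rewrite sumrB (bigD1 a1)//= eqxx big1 ?addr0 => [|c /negPf ->]; last by rewrite mulr0.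
  rewrite (bigD1 a2)//= eqxx big1 ?addr0 => [|c /negPf ->]; last by rewrite mulr0.
  by ring.
apply: (mulfI up); rewrite mulr_sumr.
move: sumA; rewrite (bigD1 p)//= => /(canRL (addrK _)) ->; rewrite sub0r -sumrN.
by apply: eq_big => [c|c _]; [rewrite !inE | field].
Qed.

(** The flattening is linear in the family, so recombining by G multiplies it on the left by G (x)
    1. *)
Lemma rank_skew_comb (E E' A B : finType) (X : E -> A -> B -> F) (G : E' -> E -> F)
    (X' : E' -> A -> B -> F) :
  (forall e a b, X' e a b = \sum_k G e k * X k a b) ->
  (\rank (fmx (skew X')) <= \rank (fmx (skew X)))%N.
Proof.
move=> X'E; have -> : fmx (skew X') =
    fmx (fun (x : E' * A) (y : E * A) => G x.1 y.1 * (x.2 == y.2)%:R) *m fmx (skew X).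
  rewrite mul_fmx; apply: eq_fmx => -[e a] [[a1 a2] b].
  have -> : \sum_d G e d.1 * (a == d.2)%:R * skew X d (a1, a2, b) =
      \sum_k G e k * skew X (k, a) (a1, a2, b).
    rewrite sum_pair /=; apply: eq_bigr => k _.
    rewrite (bigD1 a)//= eqxx mulr1 big1 ?addr0// => c.
    by rewrite eq_sym => /negPf ->; rewrite mulr0 mul0r.
  rewrite /skew /=; under [RHS]eq_bigr do rewrite mulrBr.
  rewrite sumrB; congr (_ - _).
    by case: ifP => _; [exact: X'E | rewrite big1// => k _; rewrite mulr0].
  by case: ifP => _; [exact: X'E | rewrite big1// => k _; rewrite mulr0].
exact: mxrankM_maxr.
Qed.

(* Grading the rows and columns so that M is block triangular, M0 is its diagonal part. *)
Lemma det_leading (s : nat) (M M0 : 'M[F]_s) (rd cd : 'I_s -> nat) :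
  (forall i j, M i j != 0 -> (rd i <= cd j)%N) ->
  (forall i j, M0 i j = if rd i == cd j then M i j else 0) ->
  \det M0 != 0 -> \det M = \det M0.
Proof.
move=> Mle M0E detM0.
have [s0 prod_s0] : exists s0 : 'S_s, \prod_i M0 i (s0 i) != 0.
  apply/existsP; apply: contraNT detM0 => /existsPn h.
  rewrite /determinant big1// => t _; move: (h t); rewrite negbK => /eqP ->.
  by rewrite mulr0.
(* A surviving term of [\det M0] forces equal total degrees, so every nonzero term of [\det M],
   where degrees satisfy rd <= cd factor by factor, has equality throughout. *)
have sum_deg : (\sum_i rd i = \sum_i cd i)%N.
  rewrite [RHS](reindex_inj (@perm_inj _ s0)); apply: eq_bigr => i _.
  move/prodf_neq0: prod_s0 => /(_ i isT); rewrite M0E.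
  by case: (rd i =P _) => //; rewrite eqxx.
apply: eq_bigr => t _; congr (_ * _).
case: (boolP [forall i, M i (t i) != 0]) => [/forallP Mt|/forallPn[i]]; last first.
  rewrite negbK => /eqP Mi.
  rewrite (bigD1 i)//= Mi mul0r (bigD1 i)//= M0E Mi if_same mul0r//.
have le_i i : (rd i <= cd (t i))%N by exact: Mle.
have eq_i i : rd i = cd (t i).
  apply/eqP; rewrite eqn_leq le_i /= leqNgt; apply/negP => lt_i.
  have : (\sum_i rd i < \sum_i cd (t i))%N.
    rewrite (bigD1 i)//= [X in (_ < X)%N](bigD1 i)//= -addSn leq_add//.
    by apply: leq_sum.
  by rewrite sum_deg [X in (X < _)%N](reindex_inj (@perm_inj _ t)) ltnn.
by apply: eq_bigr => i _; rewrite M0E eq_i eqxx.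
Qed.

(** The listed pairs select rows and columns of a lower triangular submatrix with nonzero
    diagonal. *)
Definition trig_cert (S T : Type) (f : S -> T -> int) (cs : seq (S * T)) : bool :=
  all (fun x => f x.1 x.2 != 0) cs && pairwise (fun x y => f x.1 y.2 == 0) cs.

(** The certificate is checked on the integral leading part [z]; [det_leading] carries the nonzero
    determinant over to [f]. *)
Lemma trig_cert_rank (S T : finType) (f : S -> T -> F) (z : S -> T -> int)
    (rd : S -> nat) (cd : T -> nat) (cs : seq (S * T)) :
  (forall s t, f s t != 0 -> (rd s <= cd t)%N) ->
  (forall s t, (z s t)%:~R = if rd s == cd t then f s t else 0) ->
  trig_cert z cs -> (size cs <= \rank (fmx f))%N.
Proof.
case: cs => [//|x0 cs] fle fz /andP[]; set cs' := x0 :: cs.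
move=> /(all_nthP x0) zneq0 /(pairwiseP x0) z0.
pose x (i : 'I_(size cs')) := nth x0 cs' i.
pose M := \matrix_(i, j) f (x i).1 (x j).2.
pose M0 := \matrix_(i, j) ((z (x i).1 (x j).2)%:~R : F).
have detM0 : \det M0 != 0.
  rewrite det_trig.
    by apply/prodf_neq0 => i _; rewrite mxE intr_eq0 zneq0.
  apply/is_trig_mxP => i j ij; rewrite mxE.
  by have /eqP -> := z0 i j (ltn_ord i) (ltn_ord j) ij.
have detM : \det M != 0.
  rewrite (det_leading (M0 := M0) (rd := fun i => rd (x i).1) (cd := fun j => cd (x j).2))//.
  - by move=> i j; rewrite mxE; exact: fle.
  - by move=> i j; rewrite !mxE fz.
apply: leq_trans (rank_fmx_reindex f (fun i => (x i).1) (fun j => (x j).2)).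
by rewrite mxrank_unit// unitmxE unitfE.
Qed.

End Skew.

(** * The torus-fixed candidates for 2 x 2 matrices *)

Notation bool2 := (bool * bool)%type.

(** The index c is transposed relative to [matmul_tensor]: slice c is the entry (c.1, c.2) of a
    product of two matrices. *)
Definition mm2 (c a b : bool2) : bool := [&& c.1 == a.1, a.2 == b.1 & b.2 == c.2].

(* Weights of a one-parameter torus fixing M_<2>; they separate the 12 coordinates
   of A (x) B outside {((i,1),(1,l))}, which span a complement of M_<2>(C^* ). *)
Definition wtA (a : bool2) : nat := (a.1 + 4 * a.2)%N.
Definition wtB (b : bool2) : nat := (2 * b.2 + 4 * ~~ b.1)%N.
Definition wt (a b : bool2) : nat := (wtA a + wtB b)%N.
Definition pivotal (a b : bool2) : bool := ~~ (a.2 && b.1).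

Definition ext_family (V : Type) (t : bool2 -> bool2 -> bool2 -> V) (p q : bool2 -> bool2 -> V)
    (e : bool2 + bool) : bool2 -> bool2 -> V :=
  match e with inl c => t c | inr false => p | inr true => q end.

Definition lead_family (a1 b1 a2 b2 : bool2) : bool2 + bool -> bool2 -> bool2 -> int :=
  ext_family (fun c a b => (mm2 c a b : nat)%:Z)
    (fun a b => ((a == a1) && (b == b1) : nat)%:Z)
    (fun a b => ((a == a2) && (b == b2) : nat)%:Z).

Definition swap (V : Type) (X : bool2 + bool -> bool2 -> bool2 -> V) e a b := X e b a.

(* Pivots of a sparse matrix, given by the list of its nonzero positions: a position
   alone in its column goes last, one alone in its row goes first. *)
Fixpoint peel (fuel : nat) (es : seq (nat * nat)) : seq (nat * nat) :=
  let alone (g : nat * nat -> nat) :=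
    [seq e <- es | count (fun e' => eqn (g e') (g e)) es == 1%N] in
  let rest e := [seq e' <- es | ~~ eqn e'.1 e.1 && ~~ eqn e'.2 e.2] in
  if fuel is fuel'.+1 then
    if alone snd is e :: _ then rcons (peel fuel' (rest e)) e
    else if alone fst is e :: _ then e :: peel fuel' (rest e)
    else [::]
  else [::].

Definition bool2s : seq bool2 := [:: (false, false); (false, true); (true, false); (true, true)].
Definition rows24 : seq ((bool2 + bool) * bool2) :=
  [seq (e, a) | e <- [seq inl c | c <- bool2s] ++ [:: inr false; inr true], a <- bool2s].
(** Keeping increasing pairs only gives a basis of Lambda^2 A (x) B. *)
Definition cols24 : seq (bool2 * bool2 * bool2) :=
  [seq (a, b) | a <- [seq x <- [seq (x, y) | x <- bool2s, y <- bool2s] |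
                        (index x.1 bool2s < index x.2 bool2s)%N], b <- bool2s].

Definition cert (X : bool2 + bool -> bool2 -> bool2 -> int) :
    seq (((bool2 + bool) * bool2) * (bool2 * bool2 * bool2)) :=
  let x0 := (inr true, (true, true)) in let y0 := ((true, true), (true, true), (true, true)) in
  let edges := [seq e <- [seq (i, j) | i <- iota 0 24, j <- iota 0 24] |
                  skew X (nth x0 rows24 e.1) (nth y0 cols24 e.2) != 0] in
  [seq (nth x0 rows24 e.1, nth y0 cols24 e.2) | e <- peel 19 edges].

(** The pivots proposed by [peel] are rechecked here, so nothing has to be proved about [peel]. The
    threshold 19 is 6 * 3 + 1. *)
Definition certified X := trig_cert (skew X) (cert X) && (size (cert X) == 19)%N.

(** The 12 pivotal positions have distinct weights, so ordering by weight meets each of the 66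
    unordered pairs once. *)
Definition all_certified : bool :=
  all (fun a1 => all (fun b1 => all (fun a2 => all (fun b2 =>
    [&& pivotal a1 b1, pivotal a2 b2 & (wt a1 b1 < wt a2 b2)%N] ==>
    certified (lead_family a1 b1 a2 b2) || certified (swap (lead_family a1 b1 a2 b2)))
   bool2s) bool2s) bool2s) bool2s.

Lemma all_certifiedT : all_certified.
Proof. by lazy. Qed.

Lemma certifiedP X : certified X -> exists2 cs, trig_cert (skew X) cs & size cs = 19%N.
Proof.
rewrite /certified; move: (cert X) => cs /andP[cert_cs /eqP size_cs].
by exists cs.
Qed.

Lemma wt_inj a b a' b' : pivotal a b -> pivotal a' b' -> wt a b = wt a' b' -> (a, b) = (a', b').
Proof. by move: a b a' b' => [[] []] [[] []] [[] []] [[] []]. Qed.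

Section TwoByTwo.
Variable F : numFieldType.
Implicit Types p q : bool2 -> bool2 -> F.

(** A vector reduced modulo the slices of M_<2> and scaled; as weights separate pivotal positions,
    its lowest-weight part is a single basis vector. *)
Definition leads p (a b : bool2) : Prop :=
  [/\ pivotal a b, p a b = 1, forall a' b', ~~ pivotal a' b' -> p a' b' = 0 &
      forall a' b', (wt a' b' < wt a b)%N -> p a' b' = 0].

Definition mm2_family : bool2 -> bool2 -> bool2 -> F := fun c a b => (mm2 c a b)%:R.

(** Here [Z] is the lowest-weight part of [X]. Wedging with [a] adds [wa a] to the weight, so the
    flattening of [Z] is the leading part of that of [X], and its rank can only be smaller. *)
Lemma skew_graded_rank (X : bool2 + bool -> bool2 -> bool2 -> F)
    (Z : bool2 + bool -> bool2 -> bool2 -> int)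
    (de : bool2 + bool -> nat) (wa wb : bool2 -> nat) :
  (forall e a b, X e a b != 0 -> (de e <= wa a + wb b)%N) ->
  (forall e a b, (Z e a b)%:~R = if de e == (wa a + wb b)%N then X e a b else 0) ->
  certified Z -> (18 < \rank (fmx (skew X)))%N.
Proof.
move=> Xle ZX /certifiedP[cs cZ size_cs]; apply: (@leq_trans (size cs)); first by rewrite size_cs.
apply: (trig_cert_rank (rd := fun x => (de x.1 + wa x.2)%N)
  (cd := fun y => (wa y.1.1 + wa y.1.2 + wb y.2)%N) _ _ cZ).
- move=> [e a] [[a1 a2] b]; rewrite /skew /=.
  have h c d : (if a == c then X e d b else 0) != 0 ->
      (de e + wa a <= wa c + wa d + wb b)%N.
    by case: (a =P c) => [->|_]; [move=> /Xle; lia | rewrite eqxx].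
  move=> nz; have /orP[/h //|/h] : ((if a == a1 then X e a2 b else 0) != 0) ||
      ((if a == a2 then X e a1 b else 0) != 0).
    by apply: contraNT nz; rewrite negb_or !negbK => /andP[/eqP -> /eqP ->]; rewrite subrr.
  by rewrite (addnC (wa a2)).
- move=> [e a] [[a1 a2] b]; rewrite /skew /= rmorphB /=.
  have h c d : (if a == c then Z e d b else 0)%:~R =
     if (de e + wa a == wa c + wa d + wb b)%N then if a == c then X e d b else 0 else 0 :> F.
    by case: (a =P c) => [<-|_]; rewrite ?if_same// -addnA (addnC (de e)) eqn_add2l ZX.
  by rewrite !h [(wa a2 + wa a1)%N]addnC; case: ifP; rewrite ?subrr.
Qed.

Lemma lead_family_rank p q (a1 b1 a2 b2 : bool2) :
  leads p a1 b1 -> leads q a2 b2 -> (wt a1 b1 < wt a2 b2)%N ->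
  (18 < \rank (fmx (skew (ext_family mm2_family p q))))%N ||
  (18 < \rank (fmx (skew (swap (ext_family mm2_family p q)))))%N.
Proof.
move=> [pa pab p0 plt] [qa qab q0 qlt] ab.
(* Slices are homogeneous: when a.2 = b.1 the terms 4 * a.2 and 4 * ~~ b.1 add up to 4. *)
pose de (e : bool2 + bool) : nat := match e with
  | inl c => (c.1 + 2 * c.2 + 4)%N | inr false => wt a1 b1 | inr true => wt a2 b2 end.
have Xle e a b : ext_family mm2_family p q e a b != 0 -> (de e <= wt a b)%N.
  case: e => [[c1 c2]|[]] /=.
  - move: a b => [i j] [k l]; rewrite /mm2_family /mm2 /= pnatr_eq0 eqb0 negbK.
    by move=> /and3P[/eqP -> /eqP -> /eqP ->]; rewrite /wt /wtA /wtB /=; case: k; lia.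
  - by rewrite leqNgt; apply: contraNN => /qlt ->.
  - by rewrite leqNgt; apply: contraNN => /plt ->.
have lead r a b a' b' : leads r a' b' ->
    (((a == a') && (b == b') : nat)%:Z)%:~R = if wt a' b' == wt a b then r a b else 0 :> F.
  move=> [ra' rab r0 _]; case: (boolP (pivotal a b)) => [ra|nra].
    case: (wt a' b' =P wt a b) => [w|w].
      by have [<- <-] := wt_inj ra' ra w; rewrite !eqxx rab.
    by case: andP => // -[/eqP aa /eqP bb]; case: w; rewrite aa bb.
  rewrite r0// if_same; case: andP => // -[/eqP aa /eqP bb].
  by move: nra; rewrite aa bb ra'.
have Ze e a b : (lead_family a1 b1 a2 b2 e a b)%:~R =
    if de e == wt a b then ext_family mm2_family p q e a b else 0.
  case: e => [c|[]] /=; [|exact: lead|exact: lead].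
  rewrite -pmulrn /mm2_family; case: (boolP (mm2 c a b)) => [cab|_]; last by rewrite if_same.
  by rewrite ifT//; move: c a b cab => [[] []] [[] []] [[] []].
have inb (c : bool2) : c \in bool2s by move: c => [[] []].
have /orP[h|h] : certified (lead_family a1 b1 a2 b2) ||
    certified (swap (lead_family a1 b1 a2 b2)).
  have /allP /(_ a1 (inb _)) /allP /(_ b1 (inb _)) /allP
    /(_ a2 (inb _)) /allP /(_ b2 (inb _)) :=
    all_certifiedT.
  by move=> /implyP; apply; rewrite pa qa ab.
- by rewrite (skew_graded_rank (wa := wtA) (wb := wtB) Xle Ze h).
- apply/orP; right.
  apply: (skew_graded_rank (de := de) (wa := wtB) (wb := wtA) _ _ h) => e a b; rewrite /swap addnC.
    exact: Xle.
  exact: Ze.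
Qed.

End TwoByTwo.

(** * Leading terms in a row space and completion of spanning sets *)

Section Echelon.
Variable F : fieldType.

Lemma exists_leading q (y : 'rV[F]_q) (w : 'I_q -> nat) : y != 0 ->
  exists i, y 0 i != 0 /\ forall k, (w k < w i)%N -> y 0 k = 0.
Proof.
move=> /eqP/rowP y0; have [i0 yi0] : exists i, y 0 i != 0.
  apply/existsP; apply: contraPT y0 => /existsPn h; apply.
  by move=> i; rewrite mxE; move: (h i); rewrite negbK => /eqP.
case: (arg_minnP w (P := fun i => y 0 i != 0) yi0) => i yi imin.
exists i; split=> // k; rewrite ltnNge; apply: contraNeq; exact: imin.
Qed.

(** After normalizing one vector y, a row outside its span is cleared at the leading index of y; its
    own leading index then differs, and so does the weight, by injectivity on D. *)
Lemma exists_two_leading m q (Y : 'M[F]_(m, q)) (D : pred 'I_q) (w : 'I_q -> nat) :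
  (1 < \rank Y)%N ->
  (forall y : 'rV_q, (y <= Y)%MS -> forall i, ~~ D i -> y 0 i = 0) ->
  {in D &, injective w} ->
  exists (y z : 'rV[F]_q) i j, [/\ (y <= Y)%MS, (z <= Y)%MS, (w i < w j)%N,
    y 0 i = 1 /\ (forall k, (w k < w i)%N -> y 0 k = 0) &
    z 0 j = 1 /\ (forall k, (w k < w j)%N -> z 0 k = 0)].
Proof.
move=> rY YD wD.
have inD (y : 'rV_q) i : (y <= Y)%MS -> y 0 i != 0 -> D i.
  by move=> yY; apply: contraNT => /(YD _ yY) ->.
pose good (y : 'rV_q) i :=
  [/\ (y <= Y)%MS, y 0 i = 1 & forall k, (w k < w i)%N -> y 0 k = 0].
have get (y : 'rV_q) : (y <= Y)%MS -> y != 0 ->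
    exists i (y' : 'rV_q), [/\ good y' i, y 0 i != 0 & (y' <= y)%MS].
  move=> yY /(exists_leading w)[i [yi ilead]].
  exists i, ((y 0 i)^-1 *: y); split=> //; last exact: scalemx_sub.
  split; first by rewrite scalemx_sub.
    by rewrite mxE mulVf.
  by move=> k /ilead yk; rewrite mxE yk mulr0.
have /rowV0Pn[y0 y0Y /(get _ y0Y)[i [y [gy _ yy0]]]] : Y != 0.
  by rewrite -mxrank_eq0 -lt0n ltnW.
have [yY yi ilead] := gy.
have /row_subPn[l ly] : ~~ (Y <= y)%MS.
  apply: contraTN rY => /mxrankS; rewrite -leqNgt => /leq_trans; apply.
  exact: rank_leq_row.
pose z0 := row l Y - Y l i *: y.
have z0Y : (z0 <= Y)%MS by rewrite addmx_sub ?row_sub// eqmx_opp scalemx_sub.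
have z0_neq0 : z0 != 0.
  by apply: contraNneq ly => /eqP; rewrite subr_eq0 => /eqP ->; rewrite scalemx_sub.
have [j [z [[zY zj jlead] z0j zz0]]] := get _ z0Y z0_neq0.
have ij : w i != w j.
  have Di : D i by apply: (inD y) => //; rewrite yi oner_neq0.
  have Dj : D j by exact: (inD z0).
  move: (z0j); apply: contraNneq => /(wD i j Di Dj) <-.
  by rewrite !mxE yi mulr1 subrr.
move: ij; rewrite neq_ltn => /orP[ij|ji].
  by exists y, z, i, j.
by exists z, y, j, i.
Qed.

(** Used with P the simple tensors: basis vectors are simple, so a span of at most m simple tensors
    grows to dimension exactly m while staying spanned by simple tensors. *)
Lemma steinitz_extend q (P : 'rV[F]_q -> Prop) p (Z : 'M[F]_(p, q)) m :
  (forall i, P (delta_mx 0 i)) -> (forall i, P (row i Z)) -> (\rank Z <= m <= q)%N ->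
  exists Z' : 'M[F]_(m, q), [/\ row_free Z', (forall i, P (row i Z')) & (Z <= Z')%MS].
Proof.
move=> Pdelta PZ /andP[]; elim: m => [|m ih].
  rewrite leqn0 mxrank_eq0 => /eqP -> _; exists 0; split; last by rewrite sub0mx.
    by rewrite -row_leq_rank.
  by move=> [].
rewrite leq_eqVlt => /orP[/eqP rZ _|/ih{}ih mq].
  rewrite -rZ; exists (rowsub (maxrankfun Z) Z); split.
  - exact: maxrowsub_free.
  - by move=> i; rewrite row_rowsub; exact: PZ.
  - by rewrite eq_maxrowsub.
have [Z' [Z'free PZ' ZZ']] := ih (ltnW mq).
have /row_subPn[i iZ'] : ~~ ((1%:M : 'M[F]_q) <= Z')%MS.
  apply: contraTN mq => /mxrankS; rewrite mxrank1 => /leq_trans /(_ (rank_leq_row _)).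
  by rewrite -leqNgt.
have sub : (Z' <= col_mx (row i 1%:M) Z')%MS by rewrite -addsmxE addsmxSr.
have sub1 : (row i 1%:M <= col_mx (row i 1%:M) Z')%MS by rewrite -addsmxE addsmxSl.
have PW k : P (row k (col_mx (row i 1%:M) Z')).
  case: (split_ordP k) => k' ->; last by rewrite rowKd; exact: PZ'.
  by rewrite rowKu (ord1 k') row_id rowE mulmx1; exact: Pdelta.
exists (col_mx (row i 1%:M) Z' : 'M_(1 + m, q)); split; [| exact: PW | exact: submx_trans sub].
rewrite -row_leq_rank; move: Z'free; rewrite -row_leq_rank => /leq_ltn_trans; apply.
by apply: rank_ltmx; rewrite ltmxE sub; apply: contra iZ' => colZ'; exact: submx_trans sub1 colZ'.
Qed.

End Echelon.

(** * Excluding six-dimensional spaces that contain the slices of M_<2> *)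

Section SixDim.
Variable F : numFieldType.
Local Notation q := #|{: bool2 * bool2}|.

Definition tensors (m : nat) (M : 'M[F]_(m, q)) (e : 'I_m) (a b : bool2) : F :=
  M e (enum_rank (a, b)).

Definition mm2_rows : 'M[F]_(#|{: bool2}|, q) :=
  fmx (fun (c : bool2) (ab : bool2 * bool2) => mm2_family F c ab.1 ab.2).

Lemma no_six_dimensional_space (M : 'M[F]_(6, q)) :
  row_free M -> (mm2_rows <= M)%MS ->
  (\rank (fmx (skew (tensors M))) <= 18)%N ->
  (\rank (fmx (skew (fun e a b => tensors M e b a))) <= 18)%N -> False.
Proof.
move=> Mfree TM rA rB.
pose w (i : 'I_q) := wt (enum_val i).1 (enum_val i).2.
pose D : pred 'I_q := fun i => pivotal (enum_val i).1 (enum_val i).2.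
(* These are the four non-pivotal coordinates, on which the slices restrict to the identity. *)
pose Pi : 'M[F]_(q, #|{: bool2}|) := fmx (fun (ab : bool2 * bool2) (c : bool2) =>
  (ab == ((c.1, true), (true, c.2)))%:R).
(* Clearing the non-pivotal coordinates stays inside the row space of M and loses at most the four
   slices, so rank at least 2 remains. *)
pose Y := M - M *m Pi *m mm2_rows.
have PiE i c : Pi i (enum_rank c) = (enum_val i == ((c.1, true), (true, c.2)))%:R.
  by rewrite mxE enum_rankK.
have TPi : mm2_rows *m Pi = 1%:M.
  rewrite mul_fmx; apply/matrixP => i j; rewrite !mxE.
  rewrite (bigD1 ((enum_val j).1, true, (true, (enum_val j).2)))//= eqxx mulr1.
  rewrite big1 ?addr0 => [|ab /negPf ->]; last by rewrite mulr0.
  rewrite /mm2_family /mm2 /= -(inj_eq enum_val_inj).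
  by case: (enum_val i) (enum_val j) => [c1 c2] [d1 d2]; rewrite xpair_eqE /= (eq_sym d2).
have YPi : Y *m Pi = 0 by rewrite mulmxBl -!mulmxA TPi mulmx1 subrr.
have YM : (Y <= M)%MS by rewrite addmx_sub// eqmx_opp (submx_trans (submxMl _ _)).
have rY : (1 < \rank Y)%N.
  have : (\rank M <= \rank Y + \rank mm2_rows)%N.
    rewrite -[M in X in (X <= _)%N](subrK (M *m Pi *m mm2_rows)) -/Y.
    apply: leq_trans (mxrank_add _ _) _; rewrite leq_add2l; exact: mxrankM_maxr.
  move: Mfree; rewrite /row_free => /eqP ->.
  have c4 : #|{: bool2}| = 4%N by rewrite card_prod card_bool.
  have := leq_trans (rank_leq_row mm2_rows) (eq_leq c4); lia.
have YD (y : 'rV_q) : (y <= Y)%MS -> forall i, ~~ D i -> y 0 i = 0.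
  move=> /submxP[c ->] i; rewrite negbK => piv.
  have iE : ((enum_val i).1.1, true, (true, (enum_val i).2.2)) = enum_val i.
    by move: piv; case: (enum_val i) => [[? ?] [? ?]] /= /andP[-> ->].
  have /matrixP /(_ 0 (enum_rank ((enum_val i).1.1, (enum_val i).2.2))) : c *m Y *m Pi = 0.
    by rewrite -mulmxA YPi mulmx0.
  rewrite mxE [RHS]mxE (bigD1 i)//= big1 ?addr0.
    by move=> <-; rewrite PiE iE eqxx mulr1.
  by move=> i' ii'; rewrite PiE iE (inj_eq enum_val_inj) (negPf ii') mulr0.
have wD : {in D &, injective w}.
  move=> i j iD jD /(wt_inj iD jD); rewrite -!surjective_pairing.
  exact: enum_val_inj.
have [y [z [i [j [yY zY ij [yi ylt] [zj zlt]]]]]] := exists_two_leading rY YD wD.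
pose fam (x : 'rV[F]_q) (a b : bool2) := x 0 (enum_rank (a, b)).
have D_of (x : 'rV_q) k : (x <= Y)%MS -> x 0 k = 1 -> D k.
  by move=> xY xk; apply: contraT => /(YD _ xY)/eqP; rewrite xk oner_eq0.
have lead (x : 'rV_q) k : (x <= Y)%MS -> x 0 k = 1 ->
    (forall k', (w k' < w k)%N -> x 0 k' = 0) ->
    leads (fam x) (enum_val k).1 (enum_val k).2.
  move=> xY xk xlt; split; first exact: (D_of x).
  - by rewrite /fam -surjective_pairing enum_valK.
  - by move=> a b nab; apply: (YD _ xY); rewrite /D enum_rankK.
  - by move=> a b ab; apply: xlt; rewrite /w enum_rankK.
pose X := ext_family (mm2_family F) (fam y) (fam z).
pose rw (e : bool2 + bool) : 'rV[F]_q := match e with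
  | inl c => row (enum_rank c) mm2_rows | inr false => y | inr true => z end.
have rwM e : (rw e <= M)%MS.
  case: e => [c|[]] /=; [|exact: submx_trans zY YM|exact: submx_trans yY YM].
  exact: submx_trans (row_sub _ _) TM.
have XE e a b : X e a b = \sum_k (rw e *m pinvmx M) 0 k * tensors M k a b.
  have -> : X e a b = rw e 0 (enum_rank (a, b)).
    case: e => [c|[]] //=; by rewrite !mxE !enum_rankK.
  by rewrite -{1}(mulmxKpV (rwM e)) mxE.
have /orP[h|h] := lead_family_rank (lead y i yY yi ylt) (lead z j zY zj zlt) ij.
- by have := leq_trans h (leq_trans (rank_skew_comb XE) rA).
- have XE' e a b : swap X e a b =
      \sum_k (rw e *m pinvmx M) 0 k * tensors M k b a by exact: XE.
  by have := leq_trans h (leq_trans (rank_skew_comb XE') rB).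
Qed.

End SixDim.

From mathcomp Require Import boolp classical_sets filter topology normedtype.
From mathcomp Require Import sequences reals interval_inference Rstruct complex.
Import numFieldNormedType.Exports.

(** * Limits along an ultrafilter *)

Section Limits.
Local Open Scope classical_set_scope.
Local Open Scope ring_scope.

(** With U an ultrafilter, bounded sequences converge without extracting subsequences. *)
Definition clim (R : realType) (U : set_system nat) (x : nat -> R[i]) (l : R[i]) : Prop :=
  (fun k => complex.Re (x k)) @ U --> complex.Re l /\
  (fun k => complex.Im (x k)) @ U --> complex.Im l.

Variables (R : realType) (U : set_system nat).
Context {UU : UltraFilter U}.
Local Notation C := R[i].
Implicit Types (x y : nat -> C) (a b l : C).

Lemma clim_cst a : clim U (fun=> a) a.
Proof. by split; exact: cvg_cst. Qed.

Lemma climD x y a b : clim U x a -> clim U y b -> clim U (fun k => x k + y k) (a + b).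
Proof.
move=> [xr xi] [yr yi]; split.
- under eq_fun do rewrite raddfD; rewrite raddfD; exact: cvgD.
- under eq_fun do rewrite raddfD; rewrite raddfD; exact: cvgD.
Qed.

Lemma climM x y a b : clim U x a -> clim U y b -> clim U (fun k => x k * y k) (a * b).
Proof.
have ReM (u v : C) : complex.Re (u * v) =
    complex.Re u * complex.Re v - complex.Im u * complex.Im v by case: u v => [? ?] [].
have ImM (u v : C) : complex.Im (u * v) =
    complex.Re u * complex.Im v + complex.Im u * complex.Re v by case: u v => [? ?] [].
move=> [xr xi] [yr yi]; split.
- under eq_fun do rewrite ReM; rewrite ReM.
  by apply: cvgB; apply: cvgM.
- under eq_fun do rewrite ImM; rewrite ImM.
  by apply: cvgD; apply: cvgM.
Qed.

Lemma climN x a : clim U x a -> clim U (fun k => - x k) (- a).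
Proof.
by move=> /(climM (clim_cst (-1))); rewrite mulN1r; under eq_fun do rewrite mulN1r.
Qed.

Lemma climB x y a b : clim U x a -> clim U y b -> clim U (fun k => x k - y k) (a - b).
Proof. by move=> xa /climN; exact: climD. Qed.

Lemma clim_sum (I : Type) (s : seq I) (P : pred I) (x : I -> nat -> C) (a : I -> C) :
  (forall i, P i -> clim U (x i) (a i)) ->
  clim U (fun k => \sum_(i <- s | P i) x i k) (\sum_(i <- s | P i) a i).
Proof.
move=> xa; elim: s => [|i s ih].
  by rewrite big_nil; under eq_fun do rewrite big_nil; exact: clim_cst.
rewrite big_cons; under eq_fun do rewrite big_cons.
by case: ifP => // Pi; apply: climD => //; exact: xa.
Qed.

Lemma clim_prod (I : Type) (s : seq I) (P : pred I) (x : I -> nat -> C) (a : I -> C) :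
  (forall i, P i -> clim U (x i) (a i)) ->
  clim U (fun k => \prod_(i <- s | P i) x i k) (\prod_(i <- s | P i) a i).
Proof.
move=> xa; elim: s => [|i s ih].
  by rewrite big_nil; under eq_fun do rewrite big_nil; exact: clim_cst.
rewrite big_cons; under eq_fun do rewrite big_cons.
by case: ifP => // Pi; apply: climM => //; exact: xa.
Qed.

Lemma clim_conj x a : clim U x a -> clim U (fun k => (x k)^*) (a^*).
Proof.
move=> [xr xi]; have e (z : C) : z^* = (complex.Re z -i* complex.Im z)%C by case: z.
split; first by under eq_fun do rewrite e; rewrite e.
by under eq_fun do rewrite e; rewrite e /=; exact: cvgN.
Qed.

Lemma clim_unique x a b : clim U x a -> clim U x b -> a = b.
Proof.
case: a b => [ar ai] [br bi] [/= xr xi] [/= yr yi].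
by congr (_ +i* _)%C; [move: xr yr | move: xi yi]; apply: cvg_unique; exact: norm_hausdorff.
Qed.

Lemma clim_near_eq x y a : U [set k | x k = y k]%classic -> clim U x a -> clim U y a.
Proof.
move=> xy [xr xi]; split.
- by apply: cvg_trans xr; apply: near_eq_cvg; apply: filterS xy => k /= ->.
- by apply: cvg_trans xi; apply: near_eq_cvg; apply: filterS xy => k /= ->.
Qed.

(** The image of U under a bounded real sequence is an ultrafilter on a compact segment, hence
    converges. *)
Lemma bounded_clim x (M : R) :
  (forall k, `|complex.Re (x k)| <= M /\ `|complex.Im (x k)| <= M) ->
  exists a, clim U x a.
Proof.
move=> xM.
have real_lim (f : nat -> R) : (forall k, `|f k| <= M) -> exists a : R, f @ U --> a.
  move=> fM; have := @segment_compact R (- M) M.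
  rewrite compact_ultra => /(_ (f @ U)%classic) [].
    - split=> [|G GF fG]; first exact: fmap_proper_filter.
      rewrite predeqE => A; split => [GA|]; last exact: fG.
      have [//|UnA] := in_ultra_setVsetC (f @^-1` A) UU.
      have GnA : G (~` A) by exact: fG.
      by have [a []] := filter_ex (filterI GA GnA).
    - suff: U (f @^-1` `[- M, M]%classic) by [].
      by apply: filterE => k; rewrite /= in_itv /= -ler_norml fM.
  by move=> a [_ fa]; exists a.
have [|a xa] := real_lim (fun k => complex.Re (x k)); first by move=> k; case: (xM k).
have [|b xb] := real_lim (fun k => complex.Im (x k)); first by move=> k; case: (xM k).
by exists (a +i* b)%C.
Qed.

Lemma clim_det n (A : nat -> 'M[C]_n) (B : 'M[C]_n) :
  (forall i j, clim U (fun k => A k i j) (B i j)) -> clim U (fun k => \det (A k)) (\det B).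
Proof.
move=> AB; apply: clim_sum => s _; apply: climM; first exact: clim_cst.
exact: clim_prod.
Qed.

Lemma clim_mulmx m n p (A : nat -> 'M[C]_(m, n)) (A0 : 'M_(m, n))
  (B : nat -> 'M[C]_(n, p)) (B0 : 'M_(n, p)) :
  (forall i j, clim U (fun k => A k i j) (A0 i j)) ->
  (forall i j, clim U (fun k => B k i j) (B0 i j)) ->
  forall i j, clim U (fun k => (A k *m B k) i j) ((A0 *m B0) i j).
Proof.
move=> AA BB i j; under eq_fun do rewrite mxE; rewrite mxE.
by apply: clim_sum => l _; apply: climM.
Qed.

(* A matrix B of rank q satisfies P B Q = 1 for some P, Q of inner size q, and
   det (P A_k Q) vanishes as soon as A_k has rank < q. *)
Lemma clim_rank m n (A : nat -> 'M[C]_(m, n)) (B : 'M[C]_(m, n)) (q : nat) :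
  (forall i j, clim U (fun k => A k i j) (B i j)) ->
  U [set k | (\rank (A k) <= q)%N]%classic -> (\rank B <= q)%N.
Proof.
move=> AB Aq; rewrite leqNgt; apply/negP => qB.
have [P [Q PBQ]] : exists P Q, P *m B *m Q = 1%:M :> 'M_(\rank B).
  exists (row_base B *m pinvmx B), (pinvmx (row_base B)).
  by rewrite mulmxKpV ?eq_row_base// mulmxVp ?row_base_free.
have : clim U (fun k => \det (P *m A k *m Q)) (\det (P *m B *m Q)).
  apply: clim_det; apply: clim_mulmx => [|i j]; last exact: clim_cst.
  by apply: clim_mulmx => // i j; exact: clim_cst.
rewrite PBQ det1 => /(clim_near_eq (y := fun=> 0)) h.
have /h /(clim_unique (clim_cst 0)) /eqP : U [set k | \det (P *m A k *m Q) = 0]%classic.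
  apply: filterS Aq => k /= Aq.
  apply/eqP; rewrite -[_ == _]negbK -unitfE -unitmxE -row_free_unit /row_free.
  rewrite neq_ltn (leq_ltn_trans _ qB)//.
  by apply: leq_trans (mxrankM_maxl _ _) _; apply: leq_trans (mxrankM_maxr _ _) _.
by rewrite eq_sym oner_eq0.
Qed.

(** Otherwise U would contain the complements of all the finitely many fibres, whose intersection is
    empty. *)
Lemma ultra_finite_choice (T : finType) (f : nat -> T) :
  exists c, U [set k | f k = c]%classic.
Proof.
apply: contrapT => nf.
have : \forall k \near U, forall c, f k != c.
  apply: filter_forall => c.
  have [h|h] := in_ultra_setVsetC [set k | f k = c]%classic UU; first by case: nf; exists c.
  by apply: filterS h => k /eqP.
by move=> /filter_ex[k /(_ (f k))]; rewrite eqxx.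
Qed.

Lemma clim_of_close x a :
  \oo `<=` U ->
  (forall k, `|complex.Re a - complex.Re (x k)| < k.+1%:R^-1 /\
             `|complex.Im a - complex.Im (x k)| < k.+1%:R^-1) -> clim U x a.
Proof.
move=> sU xa.
have cvg (y : nat -> R) (b : R) : (forall k, `|b - y k| < k.+1%:R^-1) -> y @ U --> b.
  move=> yb; apply/cvgrPdist_lt => e e0; apply: sU.
  by apply: filterS (near_infty_natSinv_lt (PosNum e0)) => k /=; exact: lt_trans.
by split; apply: cvg => k; case: (xa k).
Qed.

End Limits.

Lemma ultrafilter_nat : exists2 U : set_system nat, UltraFilter U & (\oo `<=` U)%classic.
Proof. by have [U [UU sU]] := ultraFilterLemma eventually_filter; exists U. Qed.

Definition mmtensor (F : fieldType) (n : nat) (a b c : 'I_n * 'I_n) : F :=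
  [&& a.2 == b.1, b.2 == c.1 & c.2 == a.1]%:R.

(** Compare with 'C(m + 2, 2). For m = 1 both sides equal 2, which is why n = 2 needs another
    argument. *)
Lemma bin_central_gt m : (1 < m)%N -> (m.+1 < 'C(m + m, m))%N.
Proof.
move=> m1; apply: (@leq_trans 'C(m.+2, m)); last by apply: leq_bin2l; lia.
rewrite -bin_sub; last by lia.
rewrite (_ : m.+2 - m = 2)%N; last by lia.
by rewrite bin2 /=; lia.
Qed.

(** * The bound for n at least 3 *)

Section KoszulBorder.
Variables (R : realType) (U : set_system nat).
Context {UU : UltraFilter U}.
Local Notation C := R[i].

(** Dividing by an entry of largest modulus bounds the vector and leaves an entry equal to 1, which
    keeps the limit nonzero. *)
Lemma normalize_vector (A : finType) (a0 : A) (u : A -> C) :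
  exists (p : A) (y : A -> C) (c : C),
    [/\ y p = 1, forall a, `|y a| <= 1 & forall a, u a = c * y a].
Proof.
case: (pickP (fun a => u a != 0)) => [a1 ua1|u0]; last first.
  exists a0, (fun a => (a == a0)%:R), 0; split=> [|a|a]; first by rewrite eqxx.
    by case: (a == a0); rewrite ?normr1 ?normr0.
  by move/negbFE: (u0 a) => /eqP ->; rewrite mul0r.
pose p := [arg max_(p > a1) complex.Re `|u p|]%O.
have up a : `|u a| <= `|u p|.
  have Rmax : complex.Re `|u a| <= complex.Re `|u p|.
    by rewrite /p; case: arg_maxP => // q _ /(_ a isT).
  by move: Rmax; rewrite !normc_def /= lecR.
have up0 : u p != 0 by rewrite -normr_gt0 (lt_le_trans _ (up a1)) ?normr_gt0.
exists p, (fun a => u a / u p), (u p); split => [|a|a]; first by rewrite divff.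
  by rewrite normrM normfV ler_pdivrMr ?normr_gt0// mul1r.
by rewrite mulrCA divff// mulr1.
Qed.

Lemma bounded_family_clim (A : Type) (y : nat -> A -> C) :
  (forall k a, `|y k a| <= 1) -> exists x : A -> C, forall a, clim U (fun k => y k a) (x a).
Proof.
move=> y1; have /choice[x xP] : forall a, exists l, clim U (fun k => y k a) l.
  move=> a; apply: (bounded_clim (M := 1)) => k.
  have := y1 k a; rewrite normc_def -[1]/(1%:C%C) lecR => h.
  split; apply: le_trans h; rewrite -sqrtr_sqr; apply: ler_wsqrtr.
    by rewrite lerDl sqr_ge0.
  by rewrite lerDr sqr_ge0.
by exists x.
Qed.

(* The projection of A killing the limit of the normalized first factor y; at finite
   stage k it is corrected by a rank-one term so as to kill y k itself. *)
Lemma koszul_border_bound m r (u v w : nat -> 'I_r -> 'I_m.+1 * 'I_m.+1 -> C) :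
  (1 < m)%N ->
  (forall a b c, clim U (fun k => \sum_t u k t a * v k t b * w k t c) (mmtensor C a b c)) ->
  (m.+1 * (m + m).+1 < r)%N.
Proof.
move=> m1; case: r u v w => [|r] u v w uvwT.
  have := uvwT (ord0, ord0) (ord0, ord0) (ord0, ord0).
  under eq_fun do rewrite big_ord0.
  move=> /(clim_unique (clim_cst 0))/esym/eqP.
  by rewrite /mmtensor /= oner_eq0.
rewrite ltnS; set n := m.+1; set N := (m + m).+1.
pose A := ('I_n * 'I_n)%type.
have /choice[p /choice[y /choice[c0 uE]]] := fun k => normalize_vector (ord0, ord0) (u k ord0).
(* The position of the entry 1 is constant along U, so the limit x satisfies [x q = 1]. *)
have [q pq] := ultra_finite_choice (U := U) p.
have [|x yx] := @bounded_family_clim A y; first by move=> k a; case: (uE k).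
have xq : x q = 1.
  apply: (clim_unique (yx q)); apply: clim_near_eq (clim_cst 1).
  by apply: filterS pq => k /= <-; case: (uE k) => ->.
have [|g [h [J0 [l0 [gh J0n l0J0 gg gxh]]]]] :=
    @annihilating_forms _ m (\matrix_(i, j) x (i, j)) (ltnW m1).
  apply/eqP => /matrixP /(_ q.1 q.2); rewrite !mxE -surjective_pairing xq => /eqP.
  by rewrite oner_eq0.
pose Lam (z : A -> C) l := \sum_a g l a.1 * z a * h l a.2.
have Lx l : Lam x l = 0.
  rewrite -[RHS](gxh l) /Lam sum_pair; apply: eq_bigr => i _; apply: eq_bigr => j _.
  by rewrite mxE.
(* Along U [y k q = 1], so these forms kill [y k]; the correction tends to 0 because [Lam x]
   vanishes. *)
pose la k l a := g l a.1 * h l a.2 - (a == q)%:R * Lam (y k) l.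
pose S k l b c := \sum_(t < r) (\sum_a la k l a * u k (lift ord0 t) a) *
   v k (lift ord0 t) b * w k (lift ord0 t) c.
have la_clim l a : clim U (fun k => la k l a) (g l a.1 * h l a.2).
  have -> : g l a.1 * h l a.2 = g l a.1 * h l a.2 - (a == q)%:R * Lam x l.
    by rewrite Lx mulr0 subr0.
  apply: climB; first exact: clim_cst.
  apply: climM; first exact: clim_cst.
  apply: clim_sum => a' _; apply: climM; last exact: clim_cst.
  by apply: climM; [exact: clim_cst|exact: yx].
have S_clim l b c : clim U (fun k => S k l b c) (h l b.1 * g l c.2 * (b.2 == c.1)%:R).
  have -> : h l b.1 * g l c.2 * (b.2 == c.1)%:R =
      \sum_a g l a.1 * h l a.2 * mmtensor C a b c.
    rewrite (bigD1 (c.2, b.1))//= big1 ?addr0 => [|a ab].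
      by rewrite /mmtensor /= !eqxx andbT (mulrC (g _ _)).
    rewrite /mmtensor; case: and3P => [[/eqP a2 _ /eqP a1]|]; last by rewrite mulr0.
    by move: ab; rewrite [a]surjective_pairing a2 a1 eqxx.
  have : clim U (fun k => \sum_a la k l a * (\sum_t u k t a * v k t b * w k t c))
      (\sum_a g l a.1 * h l a.2 * mmtensor C a b c).
    by apply: clim_sum => a _; apply: climM.
  apply: clim_near_eq; apply: filterS pq => k /= pkq.
  have u0 : \sum_a la k l a * u k ord0 a = 0.
    have [yp _ {}uE] := uE k; rewrite pkq in yp.
    transitivity (c0 k * (Lam (y k) l - \sum_a (a == q)%:R * y k a * Lam (y k) l)).
      rewrite /Lam -sumrB mulr_sumr; apply: eq_bigr => a _; rewrite uE /la /Lam; ring.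
    rewrite (bigD1 q)//= eqxx yp !mul1r big1 ?addr0 ?subrr ?mulr0// => a /negPf ->.
    by rewrite !mul0r.
  under eq_bigr do rewrite mulr_sumr.
  rewrite exchange_big big_ord_recl /= /S.
  under eq_bigr do rewrite !mulrA.
  rewrite -!mulr_suml u0 !mul0r add0r; apply: eq_bigr => t _.
  rewrite !mulr_suml; apply: eq_bigr => a _; ring.
pose D := 'C(m + m, m).
have rS k : (\rank (fmx (koszul m (S k))) <= r * D)%N.
  have -> : fmx (koszul m (S k)) = fmx (fun x y => \sum_(t < r) koszul m
     (fun l b c => (\sum_a la k l a * u k (lift ord0 t) a) *
       v k (lift ord0 t) b * w k (lift ord0 t) c) x y).
    by apply: eq_fmx => x' y'; rewrite -koszul_sum.
  apply: leq_trans (rank_fmx_sum (d := D) _) _; last by rewrite card_ord.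
  by move=> t; exact: rank_koszul_simple.
have := koszul_rank_ge l0J0 J0n gh gg; rewrite -/n -/N; set K := fmx _ => Kge.
have Kle : (\rank K <= r * D)%N.
  apply: (@clim_rank _ U _ _ _ (fun k => fmx (koszul m (S k)))); last exact: filterE.
  move=> i j; under eq_fun do rewrite mxE; rewrite mxE /koszul /wedge.
  apply: climM; first exact: clim_cst.
  apply: clim_sum => l _; apply: climM; first exact: clim_cst.
  by apply: climM; [exact: clim_cst|exact: S_clim].
have Dn : (n < D)%N by exact: bin_central_gt.
(* This reads N D = n 'C(N, m), turning the rank bounds into n N D <= r D + n; since n < D, it
   follows that r >= n N. *)
have Dbin := mul_bin_down N m.
rewrite /= (_ : N - m = n)%N in Dbin; last by rewrite /N /n; lia.
rewrite leqNgt; apply/negP => rn.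
have : (n * (N * D) <= r * D + n)%N.
  by rewrite /D Dbin; move: Kge Kle; nia.
nia.
Qed.

End KoszulBorder.

(** * The bound for n = 2 *)

Section BorderTwo.
Local Open Scope sesquilinear_scope.
Local Open Scope ring_scope.
Variables (R : realType) (U : set_system nat).
Context {UU : UltraFilter U}.
Local Notation C := R[i].
Local Notation q := #|{: bool2 * bool2}|.

Lemma unitary_entry_le1 m n (M : 'M[C]_(m, n)) i j : M \is unitarymx -> `|M i j| <= 1.
Proof.
move=> /unitarymxP /matrixP /(_ i i); rewrite !mxE eqxx [RHS](_ : _ = 1)// => sumM.
rewrite -(@ler_pXn2r _ 2)// ?nnegrE// expr1n -sumM (bigD1 j)//=.
rewrite !mxE -normCK lerDl sumr_ge0// => k _.
by rewrite !mxE -normCK exprn_ge0.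
Qed.

Lemma rank_tensors_simple m (Z : 'M[C]_(m, q)) :
  (forall e, exists u v : bool2 -> C, forall a b, tensors Z e a b = u a * v b) ->
  (\rank (fmx (skew (tensors Z))) <= m * 3)%N /\
  (\rank (fmx (skew (fun e a b => tensors Z e b a))) <= m * 3)%N.
Proof.
move=> /choice[u /choice[v Zuv]].
have cE : (#|'I_m| * #|{: bool2}|.-1 = m * 3)%N by rewrite card_ord card_prod card_bool.
split; rewrite -cE.
- rewrite (_ : skew _ = skew (fun e a b => u e a * v e b)); first exact: rank_skew_simple.
  by congr skew; apply/funext => e; apply/funext => a; apply/funext => b.
- rewrite (_ : skew _ = skew (fun e a b => v e a * u e b)); first exact: rank_skew_simple.
  by congr skew; apply/funext => e; apply/funext => a; apply/funext => b; rewrite mulrC Zuv.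
Qed.

(** Six-dimensional spaces spanned by simple tensors are followed through orthonormal bases;
    unitarity, containment of the slices and the two rank bounds all pass to the limit. *)
Lemma two_by_two_border_bound r (u v w : nat -> 'I_r -> bool2 -> C) :
  (forall c a b, clim U (fun k => \sum_t u k t a * v k t b * w k t c) (mm2_family C c a b)) ->
  (6 < r)%N.
Proof.
move=> uvwT; rewrite ltnNge; apply/negP => r6.
pose T k : 'M[C]_(#|{: bool2}|, q) :=
  fmx (fun c (ab : bool2 * bool2) => \sum_t u k t ab.1 * v k t ab.2 * w k t c).
have [|M MP] := @choice nat 'M[C]_(6, q) (fun k M => [/\ M \is unitarymx, (T k <= M)%MS,
    (\rank (fmx (skew (tensors M))) <= 18)%N &
    (\rank (fmx (skew (fun e a b => tensors M e b a))) <= 18)%N]).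
  move=> k; pose Z : 'M[C]_(r, q) := \matrix_(t, i) (u k t (enum_val i).1 * v k t (enum_val i).2).
  have TZ : (T k <= Z)%MS.
    have -> : T k = (\matrix_(i, t) w k t (enum_val i)) *m Z.
      apply/matrixP => i j; rewrite !mxE; apply: eq_bigr => t _.
      by rewrite !mxE mulrC.
    exact: submxMl.
  pose simple (x : 'rV[C]_q) := exists u v : bool2 -> C, forall a b,
    x 0 (enum_rank (a, b)) = u a * v b.
  have [| | |Z' [Z'free Z'simple ZZ']] := @steinitz_extend _ q simple r Z 6.
  - move=> i; exists (fun a => (a == (enum_val i).1)%:R), (fun b => (b == (enum_val i).2)%:R).
    move=> a b; rewrite mxE eqxx /= -natrM mulnb -xpair_eqE -surjective_pairing.
    by rewrite -(inj_eq enum_val_inj) enum_rankK.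
  - move=> t; exists (u k t), (v k t) => a b.
    by rewrite !mxE enum_rankK.
  - rewrite (leq_trans (rank_leq_row _) r6) /=.
    by rewrite !card_prod card_bool.
  have MZ' : (schmidt Z' <= Z')%MS by rewrite eqmx_schmidt_free.
  have [|rA rB] := @rank_tensors_simple 6 Z'.
    by move=> e; have [u' [v' uv]] := Z'simple e; exists u', v' => a b; rewrite -uv mxE.
  have comb e a b : tensors (schmidt Z') e a b =
      \sum_k (schmidt Z' *m pinvmx Z') e k * tensors Z' k a b.
    by rewrite /tensors -{1}(mulmxKpV MZ') mxE.
  (* Orthonormal bases have bounded entries and stay free in the limit. *)
  exists (schmidt Z'); split.
  - by rewrite schmidt_unitarymx// !card_prod card_bool.
  - by rewrite (submx_trans TZ)// (submx_trans ZZ')// eqmx_schmidt_free.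
  - exact: leq_trans (rank_skew_comb comb) rA.
  - exact: leq_trans (rank_skew_comb (fun e a b => comb e b a)) rB.
have [|x Mx] := @bounded_family_clim R U _ ('I_6 * 'I_q)%type (fun k ij => M k ij.1 ij.2).
  by move=> k ij; apply: unitary_entry_le1; case: (MP k).
pose M0 : 'M[C]_(6, q) := \matrix_(i, j) x (i, j).
have M_clim i j : clim U (fun k => M k i j) (M0 i j) by rewrite mxE; exact: (Mx (i, j)).
have Mt_clim i j : clim U (fun k => ((M k)^t* ) i j) ((M0^t* ) i j).
  under eq_fun do rewrite !mxE; rewrite !mxE.
  by apply: clim_conj; exact: (Mx (j, i)).
have T_clim i j : clim U (fun k => T k i j) (mm2_rows C i j).
  under eq_fun do rewrite mxE; rewrite mxE; exact: uvwT.
have M0u : M0 *m M0^t* = 1%:M.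
  apply/matrixP => i j; apply: (clim_unique (U := U) (x := fun k => (M k *m (M k)^t* ) i j)).
    exact: clim_mulmx.
  apply: clim_near_eq (clim_cst _); apply: filterE => k /=.
  by case: (MP k) => /unitarymxP ->.
(* For orthonormal rows, containment of T in the row space of M is the equation T M^t* M = T, which
   is closed under limits. *)
have TM0 : mm2_rows C = mm2_rows C *m M0^t* *m M0.
  apply/matrixP => i j; apply: (clim_unique (T_clim i j)).
  apply: (clim_near_eq (x := fun k => (T k *m (M k)^t* *m M k) i j)).
    apply: filterE => k /=; case: (MP k) => /unitarymxP Mu /submxP[D ->] _ _.
    by rewrite -[D *m _ *m _]mulmxA Mu mulmx1.
  by do 2!apply: clim_mulmx => //.
have skew_clim (X : nat -> 'I_6 -> bool2 -> bool2 -> C) X0 :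
    (forall e a b, clim U (fun k => X k e a b) (X0 e a b)) ->
    (forall k, (\rank (fmx (skew (X k))) <= 18)%N) -> (\rank (fmx (skew X0)) <= 18)%N.
  move=> XX0 rX; apply: (@clim_rank _ U _ _ _ (fun k => fmx (skew (X k)))); last first.
    exact: filterE.
  move=> i j; under eq_fun do rewrite mxE; rewrite mxE /skew.
  by apply: climB; case: ifP => _ //; exact: clim_cst.
apply: (@no_six_dimensional_space _ M0).
- by rewrite /row_free mxrank_unitary//; apply/unitarymxP.
- by rewrite TM0 submxMl.
- apply: (skew_clim (fun k => tensors (M k))) => [e a b|k]; first exact: M_clim.
  by case: (MP k).
- apply: (skew_clim (fun k e a b => tensors (M k) e b a)) => [e a b|k]; first exact: M_clim.
  by case: (MP k).
Qed.

End BorderTwo.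

(** * From complex pairs to R[i] *)

Local Notation R := Rdefinitions.R.

Definition of_Cplx (z : Cplx) : R[i] := (Defs.Re z +i* Defs.Im z)%C.

Lemma of_Cplx_add z w : of_Cplx (Cadd z w) = of_Cplx z + of_Cplx w.
Proof. by []. Qed.

Lemma of_Cplx_mul z w : of_Cplx (Cmul z w) = of_Cplx z * of_Cplx w.
Proof. by []. Qed.

Lemma of_Cplx_sum r f : of_Cplx (Csum r f) = \sum_(t < r) of_Cplx (f t).
Proof.
by elim: r => [|r ih]; [rewrite big_ord0 | rewrite big_ord_recr /= -ih of_Cplx_add].
Qed.

Lemma Cmod_ge (z : Cplx) (e : R) : Rlt (Cmod z) e ->
  `|Defs.Re z| < e /\ `|Defs.Im z| < e.
Proof.
move=> ze; have le (a b : R) : Rle (Rabs a) (R_sqrt.sqrt (a * a + b * b)).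
  rewrite -R_sqrt.sqrt_Rsqr_abs; apply: R_sqrt.sqrt_le_1_alt; rewrite /Rsqr.
  by rewrite -{1}(Rplus_0_r (Rmult a a)); apply: Rplus_le_compat_l; exact: Rle_0_sqr.
split; rewrite -RabsE; apply/RltP; apply: Rle_lt_trans ze; first exact: le.
by rewrite /Cmod Rplus_comm; exact: le.
Qed.

(** Take eps = 1 / (k + 1) at stage k; [code] embeds a finite index type into the in-range pairs. *)
Lemma border_rank_sequence (n r : nat) (A : Type) (code : A -> idx) (U : set_system nat)
    {UU : UltraFilter U} : (\oo `<=` U)%classic -> (forall a, in_range n (code a)) ->
  border_rank_le n matmul_tensor r ->
  exists u v w : nat -> 'I_r -> A -> R[i], forall a b c,
    clim U (fun k => \sum_t u k t a * v k t b * w k t c)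
      (of_Cplx (matmul_tensor (code a) (code b) (code c))).
Proof.
move=> sU codeP brk.
have /choice[u /choice[v /choice[w uvw]]] : forall k : nat, exists u v w : nat -> vec,
    forall a b c, in_range n a -> in_range n b -> in_range n c ->
      Rlt (Cmod (Csub (matmul_tensor a b c)
        (Csum r (fun l => Cmul (Cmul (u l a) (v l b)) (w l c))))) (k.+1%:R^-1 : R).
  by move=> k; apply: brk; apply/RltP; rewrite invr_gt0 ltr0n.
exists (fun k t a => of_Cplx (u k t (code a))), (fun k t a => of_Cplx (v k t (code a))),
  (fun k t a => of_Cplx (w k t (code a))) => a b c.
apply: clim_of_close => // k.
have -> : \sum_(t < r) of_Cplx (u k t (code a)) * of_Cplx (v k t (code b)) *
    of_Cplx (w k t (code c)) =
    of_Cplx (Csum r (fun l => Cmul (Cmul (u k l (code a)) (v k l (code b))) (w k l (code c)))).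
  by rewrite of_Cplx_sum; apply: eq_bigr => t _; rewrite !of_Cplx_mul.
exact: Cmod_ge (uvw k _ _ _ (codeP a) (codeP b) (codeP c)).
Qed.

Lemma of_Cplx_matmul (a b c : idx) : of_Cplx (matmul_tensor a b c) =
  [&& a.2 == b.1, b.2 == c.1 & c.2 == a.1]%:R.
Proof.
have eqbE (i j : nat) : Nat.eqb i j = (i == j) by apply/idP/eqP => /Nat.eqb_eq.
by rewrite /matmul_tensor !eqbE andbA; case: ifP.
Qed.

Lemma matmul_border_bound (n r : nat) : (1 < n)%N -> border_rank_le n matmul_tensor r ->
  (n * (n + n).-1 < r)%N.
Proof.
move=> n1 brk; have [U UU sU] := ultrafilter_nat.
have [n2|n2] := eqVneq n 2.
  have [|u [v [w uvw]]] := @border_rank_sequence n r (bool * bool)%type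
      (fun a => (nat_of_bool a.1, nat_of_bool a.2)) U UU sU _ brk.
    by move=> [[] []]; split; rewrite n2; apply/ssrnat.ltP.
  (* The third factor is transposed to match the convention of [mm2]. *)
  rewrite n2; apply: (@two_by_two_border_bound _ U _ _ u v (fun k t c => w k t (c.2, c.1))).
  move=> c a b; have := uvw a b (c.2, c.1); rewrite of_Cplx_matmul /mm2_family.
  suff -> : mm2 c a b = [&& (a.2 : nat) == b.1, (b.2 : nat) == c.2 & (c.1 : nat) == a.1]. by [].
  by move: c a b {uvw} => [[] []] [[] []] [[] []].
case: n n1 n2 brk => [//|m] n1 n2 brk; rewrite addnS /=.
have [|u [v [w uvw]]] := @border_rank_sequence m.+1 r ('I_m.+1 * 'I_m.+1)%type
    (fun a => (a.1 : nat, a.2 : nat)) U UU sU _ brk.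
  by move=> [i j]; split; apply/ssrnat.ltP; exact: ltn_ord.
have m1 : (1 < m)%N by lia.
apply: (@koszul_border_bound _ U _ m r u v w m1) => a b c.
by have := uvw a b c; rewrite of_Cplx_matmul /= !val_eqE.
Qed.

Lemma matmul_border_bound_Peano (n : nat) (hn : (2 <= n)%coq_nat) (r : nat) :
  border_rank_le n matmul_tensor r -> (2 * n * n - n + 1 <= r)%coq_nat.
Proof.
move/ssrnat.leP: hn => hn /(matmul_border_bound hn) rn.
by apply/ssrnat.leP; nia.
Qed.

End BorderRank.

(* Border rank of M_<n> is >= 2n^2 - n + 1: no r with border rank <= r is smaller. *)
Theorem theorem6p2 (n : nat) (hn : (2 <= n)%nat) (r : nat) :
  border_rank_le n matmul_tensor r -> (2 * n * n - n + 1 <= r)%nat.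
Proof. exact (@BorderRank.matmul_border_bound_Peano n hn r). Qed.
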